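(* Let $G\sim G(n,1/2)$. With probability at least $1-O(n^{-1}\mathrm{polylog}\,n)$, $\bar\rho(G)\ge\left(\frac{3\pi}{8}-o(1)\right)\sqrt n$.
   Context: For a graph $G=(V,E)$ on $V=[n]$, $\bar\rho(G)$ is the minimum of $\sigma_1(M)$ (the largest singular value, equivalently the spectral radius, of $M$) over all real symmetric $n\times n$ matrices $M$ with $M_{ii}=0$ for all $i\in V$ and $M_{ij}=1$ for all edges $\{i,j\}\in E$. $G(n,1/2)$ is the Erdős–Rényi random graph. *)

(* Defs.v *)
From HB Require Import structures.
From mathcomp Require Import all_boot all_order all_algebra.
From mathcomp Require Import all_classical all_reals all_analysis.
Set Implicit Arguments. Unset Strict Implicit. Unset Printing Implicit Defensive.
Import Order.TTheory GRing.Theory Num.Theory.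
Local Open Scope ring_scope.

Definition vnorm (R : realType) (n : nat) (x : 'cV[R]_n) : R :=
  Num.sqrt (\sum_(i < n) x i 0 ^+ 2).

Definition sigma1 (R : realType) (n : nat) (M : 'M[R]_n) : R :=
  sup [set vnorm (M *m x) | x in [set x : 'cV[R]_n | vnorm x = 1]]%classic.

(* Vertex set [n] = 'I_n.  A graph on [n] is a set E of ordered pairs (i,j)
   with i < j; the edge {i,j} (i<j) is present iff (i,j) \in E. *)
Definition pairs_lt (n : nat) : {set 'I_n * 'I_n} :=
  [set p : 'I_n * 'I_n | (p.1 < p.2)%N].

Definition graphs (n : nat) : {set {set 'I_n * 'I_n}} := powerset (pairs_lt n).

Definition admissible (R : realType) (n : nat) (E : {set 'I_n * 'I_n})
  (M : 'M[R]_n) : Prop :=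
  M^T = M /\ (forall i, M i i = 0) /\ (forall i j, (i, j) \in E -> M i j = 1).

(* rho_bar(G) >= c, i.e. min over admissible M of sigma1(M) is >= c. *)
Definition rho_bar_ge (R : realType) (n : nat) (E : {set 'I_n * 'I_n}) (c : R)
  : Prop := forall M : 'M[R]_n, admissible E M -> c <= sigma1 M.

Definition prob_Gn (R : realType) (n : nat) (P : {set 'I_n * 'I_n} -> Prop) : R :=
  (#|[set E in graphs n | `[< P E >] ]|)%:R / (#|graphs n|)%:R.

(* Main.v *)
(* The adjacency matrix A is used as a dual certificate. Let W be the matrix with
   zero diagonal and entries 1 on edges and -1 on non-edges, so A = (J - I + W)/2.
   For an admissible M with s = sigma1 M, pairing with A gives
   4|E| = <W, M> + <J, M> <= s (nuc W + n), where nuc is the nuclear norm, here the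
   supremum of <W, M> over matrices M with quadratic form bounded by |x|^2. Since 4|E|
   is about n^2, it suffices that nuc W <= (8/(3 pi) + o(1)) n^(3/2).

   Flipping an edge moves nuc W by at most 4, so Efron-Stein gives a variance of
   O(n^2) and Chebyshev's inequality a failure probability of O(1/n); only the mean
   is left to estimate. With w = W / sqrt n and m odd, |x| is at most twice the
   Taylor polynomial of degree m of sqrt (1 - t) at t = 1 - x^2/4, for all real x,
   so nuc w is bounded by a combination of the traces of (4 - w^2)^k. The sums of
   weights over self-avoiding walks of length k satisfy the Chebyshev recurrence up to
   walks that close a cycle; both have bounded normalised Frobenius norm in mean,
   because distinct walks are almost orthogonal characters of the cube. Hence the
   traces converge to the moments C(2k+1, k) of the semicircle law, and the resulting
   sum is evaluated in closed form with the Wallis ratio C(2k, k)/4^k. *)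
Require Import Defs.
From HB Require Import structures.
From mathcomp Require Import all_boot all_order all_algebra.
From mathcomp Require Import all_classical all_reals all_analysis.
From mathcomp Require Import spectral complex.
From mathcomp Require Import ring lra zify.
Set Implicit Arguments. Unset Strict Implicit. Unset Printing Implicit Defensive.
Import Order.TTheory GRing.Theory Num.Theory.
Local Open Scope classical_set_scope.
Local Open Scope ring_scope.

(** * Averages over the discrete cube *)
Section Cube.
Import mathcomp.boot.fintype mathcomp.boot.finset.
Variables (R : realFieldType) (T : finType).
Implicit Types (S E : {set T}) (e : T) (F G : {set T} -> R).

Definition Ex S F : R := (\sum_(E in powerset S) F E) / 2 ^+ #|S|.

Lemma expr2_gt0 k : 0 < 2 ^+ k :> R.
Proof. by rewrite exprn_gt0. Qed.

Lemma eq_Ex S F G : (forall E, E \subset S -> F E = G E) -> Ex S F = Ex S G.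
Proof. by move=> FG; congr (_ / _); apply: eq_bigr => E; rewrite powersetE => /FG. Qed.

Lemma le_Ex S F G : (forall E, E \subset S -> F E <= G E) -> Ex S F <= Ex S G.
Proof.
move=> FG; rewrite ler_pM2r ?invr_gt0 ?expr2_gt0//.
by apply: ler_sum => E; rewrite powersetE => /FG.
Qed.

Lemma Ex_cst S (c : R) : Ex S (fun=> c) = c.
Proof.
rewrite /Ex sumr_const card_powerset. rewrite -[c *+ _]mulr_natr natrX mulfK//.
Qed.

Lemma ExD S F G : Ex S (fun E => F E + G E) = Ex S F + Ex S G.
Proof. by rewrite /Ex big_split mulrDl. Qed.

Lemma ExZ S c F : Ex S (fun E => c * F E) = c * Ex S F.
Proof. by rewrite /Ex -mulr_sumr mulrA. Qed.

Lemma ExN S F : Ex S (fun E => - F E) = - Ex S F.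
Proof. by rewrite /Ex sumrN mulNr. Qed.

Lemma Ex_sum S (I : Type) (r : seq I) (P : pred I) (F : I -> {set T} -> R) :
  Ex S (fun E => \sum_(i <- r | P i) F i E) = \sum_(i <- r | P i) Ex S (F i).
Proof. by rewrite /Ex exchange_big mulr_suml. Qed.

Lemma exists_le_Ex S F : exists2 E : {set T}, E \subset S & F E <= Ex S F.
Proof.
apply: contrapT => nE.
have h (E : {set T}) : E \subset S -> Ex S F < F E.
  by move=> ES; rewrite ltNge; apply/negP => h; apply: nE; exists E.
suff : Ex S (fun=> Ex S F) < Ex S F by rewrite Ex_cst ltxx.
rewrite ltr_pM2r ?invr_gt0 ?expr2_gt0//.
apply: ltr_sum; first by apply/hasP; exists set0;
  rewrite ?mem_index_enum// powersetE sub0set.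
by move=> E; rewrite powersetE => /h.
Qed.

Lemma big_powersetU1 e S F : e \notin S ->
  \sum_(E in powerset (e |: S)) F E = \sum_(E in powerset S) (F E + F (e |: E)).
Proof.
move=> eS; rewrite big_split /= (bigID (fun E => e \in E)) /= addrC; congr (_ + _).
  apply: eq_bigl => E; rewrite !powersetE; apply/andP/idP => [[ES eE]|ES].
    by rewrite -(setU1K eS) subsetD1 ES eE.
  split; first by apply: subset_trans ES _; exact: subsetUr.
  by apply: contra eS => /(subsetP ES).
rewrite (reindex_onto (fun E => e |: E) (fun E => E :\ e)) /=; last first.
  by move=> E /andP[_ eE]; rewrite setD1K.
apply: eq_bigl => E; rewrite !powersetE setU11 andbT.
apply/andP/idP => [[ES /eqP <-]|ES].
  by rewrite -(setU1K eS); apply: setSD.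
split; first exact: setUS.
by rewrite setU1K//; apply: contra eS => /(subsetP ES).
Qed.

Lemma ExU1 e S F : e \notin S ->
  Ex (e |: S) F = Ex S (fun E => (F E + F (e |: E)) / 2).
Proof.
move=> eS; rewrite /Ex big_powersetU1// cardsU1 eS exprS invfM mulrA.
by rewrite -mulr_suml.
Qed.

Definition flip e E : {set T} := if e \in E then E :\ e else e |: E.

Lemma in_flip e E x : (x \in flip e E) = (x == e) (+) (x \in E).
Proof.
rewrite /flip; case: ifP => eE; rewrite !inE; case: eqVneq => [->|]//=.
  by rewrite eE.
by rewrite eE.
Qed.

Lemma flipK e : involutive (flip e).
Proof. by move=> E; apply/setP => x; rewrite !in_flip addbA addbb. Qed.

Lemma Ex_flip e S F : e \in S -> Ex S (fun E => F (flip e E)) = Ex S F.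
Proof.
move=> eS; rewrite /Ex [in RHS](reindex_inj (inv_inj (flipK e))) /=.
congr (_ / _); apply: eq_bigl => E; rewrite !powersetE.
have h (A : {set T}) : A \subset S -> flip e A \subset S.
  move=> AS; apply/subsetP => x; rewrite in_flip.
  by case: eqVneq => [->//|_] /= /(subsetP AS).
by apply/idP/idP => /h //; rewrite flipK.
Qed.

Lemma Ex_flipN e S F : e \in S -> (forall E, F (flip e E) = - F E) -> Ex S F = 0.
Proof.
move=> eS FN; have := Ex_flip F eS; under eq_Ex do rewrite FN.
by rewrite ExN => h; lra.
Qed.

(* Efron-Stein inequality on the cube, by splitting off one coordinate: the
   conditional mean over it is again [c]-Lipschitz. *)
Lemma poincare S F (c : R) : (forall E e, `|F (e |: E) - F E| <= c) ->
  Ex S (fun E => F E ^+ 2) <= Ex S F ^+ 2 + c ^+ 2 / 4 * #|S|%:R.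
Proof.
have [m] := ubnP #|S|; elim: m S F => // m IHm S F Sm lipF.
have [->|[e eS]] := set_0Vmem S.
  by rewrite /Ex powerset0 !big_set1 cards0 expr0 !divr1 mulr0 addr0.
rewrite -(setD1K eS); set S' := S :\ e.
have eS' : e \notin S' by rewrite !inE eqxx.
have cS : #|S| = #|S'|.+1 by rewrite (cardsD1 e S) eS.
rewrite !ExU1// cardsU1 eS' add1n -[#|_|.+1%:R]natr1.
pose G E := (F E + F (e |: E)) / 2.
have lipG E a : `|G (a |: E) - G E| <= c.
  rewrite /G -mulrBl setUCA.
  have := lipF E a; have := lipF (e |: E) a; rewrite !ler_norml; lra.
have := IHm S' G _ lipG; rewrite -ltnS -cS => /(_ Sm).
(* The mean of two squares is the square of the mean plus the square of half the difference, and
   that half difference is at most [c / 2]. *)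
suff : Ex S' (fun E => (F E ^+ 2 + F (e |: E) ^+ 2) / 2) <=
       Ex S' (fun E => G E ^+ 2) + c ^+ 2 / 4.
  by move=> h1 h2; apply: le_trans h1 _; rewrite mulrDr mulr1 addrA lerD2r.
rewrite -[X in _ + X](Ex_cst S') -ExD; apply: le_Ex => E _.
have : (F (e |: E) - F E) ^+ 2 <= c ^+ 2.
  rewrite -real_normK ?num_real// lerXn2r ?nnegrE//.
  exact: le_trans (lipF E e).
rewrite /G /= => h; nra.
Qed.

Lemma variance_le S F (c : R) : (forall E e, `|F (e |: E) - F E| <= c) ->
  Ex S (fun E => (F E - Ex S F) ^+ 2) <= c ^+ 2 / 4 * #|S|%:R.
Proof.
move=> lipF; have lipG E e : `|F (e |: E) - Ex S F - (F E - Ex S F)| <= c.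
  by rewrite opprB addrA subrK.
apply: le_trans (poincare S lipG) _.
by rewrite ExD Ex_cst subrr expr2 mul0r add0r.
Qed.

Lemma chebyshev_le S F (c a : R) : 0 < a -> (forall E e, `|F (e |: E) - F E| <= c) ->
  Ex S (fun E => ((a <= `|F E - Ex S F|)%R)%:R) <= c ^+ 2 / 4 * #|S|%:R / a ^+ 2.
Proof.
move=> a0 lipF; rewrite ler_pdivlMr ?exprn_gt0// mulrC -ExZ.
apply: le_trans (variance_le S lipF); apply: le_Ex => E _.
have [h|_] := leP a _; last by rewrite mulr0 sqr_ge0.
by rewrite mulr1 -[leRHS]real_normK ?num_real// lerXn2r ?nnegrE// ltW.
Qed.

End Cube.

(** * Signed walks *)
Section Walks.
Import mathcomp.boot.fintype mathcomp.boot.finset.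
Variables (R : realFieldType) (n : nat).
Implicit Types (E : {set 'I_n * 'I_n}) (i j u v : 'I_n) (s t : seq 'I_n).

Definition edge i j : 'I_n * 'I_n := if (i < j)%N then (i, j) else (j, i).

(** Loops get sign 0, so that the sign matrix has zero diagonal and a walk that stays in place has
    weight 0. *)
Definition edge_sign E (e : 'I_n * 'I_n) : R :=
  if e.1 == e.2 then 0 else (-1) ^+ (e \notin E).

Fixpoint weight E i s : R :=
  if s is j :: s' then edge_sign E (edge i j) * weight E j s' else 1.

Lemma edgeC i j : edge i j = edge j i.
Proof.
rewrite /edge; case: ltngtP => // ij; congr pair; apply: val_inj; by rewrite /= ij.
Qed.

Lemma edgeii i : edge i i = (i, i). Proof. by rewrite /edge ltnn. Qed.

Lemma edge_eq u v i j :
  edge u v = edge i j -> (u = i /\ v = j) \/ (u = j /\ v = i).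
Proof. by rewrite /edge; do 2!case: ifP => _; case=> -> ->; auto. Qed.

Lemma edge_lt i j : i != j -> edge i j \in pairs_lt n.
Proof.
by rewrite /edge => ij; case: ltngtP => h; rewrite inE //=; case/eqP: ij; apply: val_inj.
Qed.

Lemma edge_sign_norm E e : `|edge_sign E e| <= 1.
Proof.
rewrite /edge_sign; case: ifP => _; first by rewrite normr0.
by rewrite normrX normrN1 expr1n.
Qed.

Lemma edge_signii E i : edge_sign E (edge i i) = 0.
Proof. by rewrite edgeii /edge_sign eqxx. Qed.

Lemma edge_sign_sqr E i j : edge_sign E (edge i j) ^+ 2 = (i != j)%:R.
Proof.
have [->|ij] := eqVneq i j; first by rewrite edge_signii expr2 mul0r.
have : edge i j \in pairs_lt n := edge_lt ij.
rewrite inE => h; rewrite /edge_sign; case: eqP => [e12|_].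
  by move: h; rewrite e12 ltnn.
by rewrite sqrr_sign.
Qed.

Lemma edge_sign_flip E e e' :
  edge_sign (flip e E) e' = (-1) ^+ (e' == e) * edge_sign E e'.
Proof.
rewrite /edge_sign; case: ifP => _; first by rewrite mulr0.
by rewrite -signr_addb in_flip; case: (_ == _); case: (_ \in E).
Qed.

Lemma weight_norm E i s : `|weight E i s| <= 1.
Proof.
elim: s i => [|j s IHs] i /=; first by rewrite normr1.
by rewrite normrM mulr_ile1// edge_sign_norm.
Qed.

Lemma weight_flip E e i s :
  weight (flip e E) i s = (-1) ^+ count_mem e (pairmap edge i s) * weight E i s.
Proof.
elim: s i => [|j s IHs] i /=; first by rewrite mul1r.
by rewrite IHs edge_sign_flip exprD; ring.
Qed.

Lemma count_edge0 u v i s :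
  v \notin i :: s -> count_mem (edge u v) (pairmap edge i s) = 0%N.
Proof.
elim: s i => [|j s IHs] i //=; rewrite !inE !negb_or => /and3P[vi vj vs].
rewrite IHs ?inE ?negb_or ?vj// addn0; apply/eqP; rewrite eqb0; apply/eqP.
by case/edge_eq=> [[_ h]|[h _]]; [rewrite h eqxx in vj | rewrite h eqxx in vi].
Qed.

(* Walks of this kind use no edge twice. *)
Definition nonbacktracking i s :=
  uniq s && (if s is _ :: j :: _ then i != j else true).

(** As [v] is visited once and is not the start, only the edges entering and leaving it contain it.
    The edge leaving it leads elsewhere than back: for empty [p] by the condition on [i], otherwise
    because the vertices of the walk are distinct. *)
Lemma count_edge1 i p v r : nonbacktracking i (p ++ v :: r) -> v != i ->
  count_mem (edge (last i p) v) (pairmap edge i (p ++ v :: r)) = 1%N.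
Proof.
move=> /andP[uq nb] vi; rewrite pairmap_cat /= count_cat /= eqxx.
have /and3P[up pv /andP[vr ur]] : [&& uniq p, ~~ has (mem p) (v :: r) & uniq (v :: r)].
  by rewrite -cat_uniq.
rewrite count_edge0; last first.
  rewrite inE negb_or vi; apply: contra pv => vp; apply/hasP; exists v => //.
  by rewrite inE eqxx.
rewrite add0n; suff -> : count_mem (edge (last i p) v) (pairmap edge v r) = 0%N by [].
case: r vr ur uq nb pv => [//|m r] /=; rewrite inE negb_or => /andP[vm vr] /andP[mr ur].
move=> uq nb pv; rewrite count_edge0 ?inE ?negb_or ?vm// addn0; apply/eqP; rewrite eqb0.
apply/eqP => /edge_eq[] [h1 h2]; first by rewrite h2 eqxx in vm.
case: p {up} uq nb pv h2 {h1} => [|a p] /= uq nb pv h2.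
  by rewrite -h2 eqxx in nb.
by have := mem_last a p; rewrite -h2 inE => h; move: pv; rewrite !inE h orbT.
Qed.

(** A vertex of [t] outside [i :: s] is entered by [t] along an edge used exactly once, and never by
    [s]. Flipping that edge negates the product. *)
Lemma Ex_weight0 i s t : nonbacktracking i t -> ~~ all (mem (i :: s)) t ->
  Ex (pairs_lt n) (fun E => weight E i s * weight E i t) = 0.
Proof.
move=> nb /allPn[v vt vs].
move: nb; case/splitPr: vt => p r nb.
have vi : v != i by apply: contra vs => /eqP->; exact: mem_head.
have uv : last i p != v.
  have vp : v \notin p.
    move: nb => /andP[+ _]; rewrite cat_uniq => /and3P[_ /hasPn h _].
    by apply: (h v); exact: mem_head.
  case: p vp {nb} => [|a p] vp; first by rewrite eq_sym.
  by apply: contraNneq vp => <-; rewrite /= mem_last.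
apply: (@Ex_flipN _ _ (edge (last i p) v)); first exact: edge_lt.
move=> E; rewrite !weight_flip count_edge0// count_edge1//.
by rewrite expr0 expr1; ring.
Qed.

Lemma big_tuple_cons k (P : pred (seq 'I_n)) (F : seq 'I_n -> R) :
  \sum_(t : k.+1.-tuple 'I_n | P t) F t =
  \sum_i \sum_(t : k.-tuple 'I_n | P (i :: t)) F (i :: t).
Proof.
rewrite pair_big_dep /=.
rewrite (reindex (fun p : 'I_n * k.-tuple 'I_n => [tuple of p.1 :: p.2])) //=.
exists (fun t : k.+1.-tuple 'I_n => (thead t, [tuple of behead t])) => [[x t] _|t _].
  by congr pair; apply: val_inj.
by rewrite /= [RHS]tuple_eta; apply: val_inj.
Qed.

Lemma card_tuple_sub k (s : seq 'I_n) :
  (#|[set t : k.-tuple 'I_n | all (mem s) t]| <= size s ^ k)%N.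
Proof.
case: s => [|a s].
  case: k => [|k]; first by rewrite expn0 -[X in (_ <= X)%N](@card_tuple 0 'I_n) max_card.
  rewrite exp0n// leqn0 cards_eq0; apply/eqP/setP => t; rewrite !inE.
  by rewrite (tuple_eta t).
pose h x : 'I_(size s).+1 := inord (index x (a :: s)).
pose f (t : k.-tuple 'I_n) := [tuple of map h t].
rewrite -(@card_in_imset _ _ f); last first.
  have fK (t : k.-tuple 'I_n) : all (mem (a :: s)) t ->
      map (fun m : 'I_(size s).+1 => nth a (a :: s) m) (f t) = t.
    move=> /allP ts; rewrite /= -map_comp map_id_in// => x /ts xs.
    by rewrite /comp /h inordK ?index_mem// nth_index.
  move=> t t'; rewrite !inE => /fK ft /fK ft' ff.
  by apply: val_inj; rewrite /= -ft -ft' ff.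
by apply: leq_trans (max_card _) _; rewrite card_tuple card_ord.
Qed.

End Walks.

(** * Frobenius norms of walk matrices and the recurrence for self-avoiding walks *)

Section WalkMatrices.
Import mathcomp.boot.fintype mathcomp.boot.finset.
Variables (R : realFieldType) (n : nat).
Implicit Types (E : {set 'I_n * 'I_n}) (i j : 'I_n) (s t : seq 'I_n).

(** Expand the square. For fixed [s] only those [t] with all vertices in [i :: s] correlate with it;
    there are at most [(k + 1) ^ k] of them, each contributing at most 1. *)
Lemma Ex_sqr_walks k i (P : pred (seq 'I_n)) :
  (forall t, P t -> nonbacktracking i t) ->
  Ex (pairs_lt n) (fun E => (\sum_(t : k.-tuple 'I_n | P t) weight R E i t) ^+ 2) <=
  (k.+1 ^ k)%:R * #|[set t : k.-tuple 'I_n | P t]|%:R.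
Proof.
move=> nb; under eq_Ex do rewrite expr2 big_distrlr.
rewrite Ex_sum mulr_natr -sumr_const; under [leRHS]eq_bigl do rewrite inE.
apply: ler_sum => s Ps; rewrite Ex_sum.
apply: le_trans (_ : \sum_(t : k.-tuple 'I_n | P t) (all (mem (i :: s)) t)%:R <= _).
  apply: ler_sum => t Pt; have [ts|/Ex_weight0 -> //] := boolP (all _ t); last exact: nb.
  rewrite -[leRHS](Ex_cst (pairs_lt n)); apply: le_Ex => E _.
  by apply: le_trans (ler_norm _) _; rewrite normrM mulr_ile1// weight_norm.
rewrite -natr_sum ler_nat.
have := card_tuple_sub k (i :: s); rewrite /= size_tuple; apply: leq_trans.
rewrite -sum1_card big_mkcond [leqRHS]big_mkcond; apply: leq_sum => t _.
by rewrite !inE; case: (P t); case: (all _ _).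
Qed.

Definition walkmx k (P : 'I_n -> pred (seq 'I_n)) E : 'M[R]_n :=
  \matrix_(i, j) \sum_(t : k.-tuple 'I_n | P i t && (last i t == j)) weight R E i t.

(** Squared Frobenius norm. *)
Definition fsq (A : 'M[R]_n) : R := \sum_i \sum_j A i j ^+ 2.

Lemma Ex_fsq_walkmx k (P : 'I_n -> pred (seq 'I_n)) :
  (forall i t, P i t -> nonbacktracking i t) ->
  Ex (pairs_lt n) (fun E => fsq (walkmx k P E)) <=
  (k.+1 ^ k)%:R * (\sum_i #|[set t : k.-tuple 'I_n | P i t]|)%:R.
Proof.
move=> nb; rewrite Ex_sum natr_sum mulr_sumr; apply: ler_sum => i _.
apply: le_trans (_ : (k.+1 ^ k)%:R *
  (\sum_j #|[set t : k.-tuple 'I_n | P i t && (last i t == j)]|)%:R <= _).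
  rewrite Ex_sum natr_sum mulr_sumr; apply: ler_sum => j _.
  under eq_Ex do rewrite mxE.
  by apply: (@Ex_sqr_walks k i (fun t => P i t && (last i t == j))) => t /andP[/nb].
rewrite ler_wpM2l// ler_nat -sum1_card.
rewrite (partition_big (fun t : k.-tuple 'I_n => last i t) predT)//=.
apply: leq_sum => j _; rewrite -sum1_card; apply/eqP/eqP/eq_leq.
by apply: eq_bigl => t; rewrite !inE.
Qed.

(** Divided by [n ^ (k / 2)], this stands in for the k-th Chebyshev polynomial of the second kind in
    the scaled sign matrix. *)
Definition pathmx k E := walkmx k (fun i t => uniq (i :: t)) E.

(* The part of [signmx E *m pathmx] in which the new first vertex [i] closes a cycle
   of length at least 3 with the path. *)
Definition lassomx k E := walkmx k (fun i t => uniq t && (i \in drop 2 t)) E.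

Definition signmx E : 'M[R]_n := \matrix_(i, j) edge_sign R E (edge i j).

Lemma Ex_fsq_pathmx k : Ex (pairs_lt n) (fun E => fsq (pathmx k E)) <=
  (k.+1 ^ k)%:R * n%:R ^+ k.+1.
Proof.
apply: le_trans (@Ex_fsq_walkmx k (fun i t => uniq (i :: t)) _) _ => [i [|a [|b t]]|].
- by [].
- by [].
- by rewrite cons_uniq => /andP[+ us]; rewrite /nonbacktracking us !inE !negb_or => /and3P[_ ->].
rewrite ler_wpM2l// -natrX ler_nat expnS -[X in (_ <= X * _)%N]card_ord -sum_nat_const.
by apply: leq_sum => i _; apply: leq_trans (max_card _) _; rewrite card_tuple card_ord.
Qed.

(** One power of [n] is saved over self-avoiding walks: the start is among the vertices of [t], so
    it has at most [k] choices. *)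
Lemma Ex_fsq_lassomx k : Ex (pairs_lt n) (fun E => fsq (lassomx k E)) <=
  (k.+1 ^ k * k)%:R * n%:R ^+ k.
Proof.
apply: le_trans (@Ex_fsq_walkmx k (fun i t => uniq t && (i \in drop 2 t)) _) _ => [i [|a [|b t]]|].
- by [].
- by rewrite in_nil andbF.
- rewrite /= drop0 /nonbacktracking => /andP[uq it].
  rewrite /= uq /=; move: uq => /and3P[_ bt _].
  by apply: contraNneq bt => <-.
rewrite natrM -mulrA ler_wpM2l// -natrX -natrM ler_nat.
under eq_bigr do rewrite -sum1_card big_mkcond.
rewrite exchange_big /= -[X in (_ ^ X)%N]/k mulnC.
rewrite -[X in (X ^ _ * _)%N]card_ord -card_tuple -sum_nat_const.
apply: leq_sum => t _; rewrite -big_mkcond sum1_card.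
apply: leq_trans (_ : #|t| <= _)%N; last by rewrite -[X in (_ <= X)%N](size_tuple t) card_size.
apply: subset_leq_card; apply/subsetP => i it.
have : t \in [set s : k.-tuple 'I_n | uniq s && (i \in drop 2 s)] := it.
rewrite inE => /andP[_ h].
have : i \in take 2 t ++ drop 2 t by rewrite mem_cat h orbT.
by rewrite cat_take_drop.
Qed.

Lemma pathmx0 E : pathmx 0 E = 1%:M.
Proof.
apply/matrixP => i j; rewrite !mxE big_mkcond (big_pred1 [tuple]); last first.
  by move=> t; apply/esym/eqP; exact: tuple0.
by rewrite /=; case: eqP.
Qed.

Lemma pathmx1 E : pathmx 1 E = signmx E.
Proof.
apply/matrixP => i j; rewrite !mxE.
rewrite (big_tuple_cons _ (fun t => uniq (i :: t) && (last i t == j))) /=.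
rewrite (bigD1 j)//= [X in _ + X]big1 => [|l lj].
  rewrite addr0 big_mkcond (big_pred1 [tuple]); last by move=> t; apply/esym/eqP; exact: tuple0.
  rewrite /= eqxx inE !andbT mulr1; case: eqVneq => //= ->.
  by rewrite edge_signii.
by rewrite big1// => t; rewrite (tuple0 t) /= (negbTE lj) andbF.
Qed.

(** Prepend [i] to a path. Either [i] is new and the path gets longer, or it is the second vertex of
    the path and the step backtracks, or it lies further on and a cycle closes. If [i] is the first
    vertex of the path, the weight is 0. *)
Lemma signmx_pathmx k E : signmx E *m pathmx k.+1 E =
  pathmx k.+2 E + (n%:R - k.+1%:R) *: pathmx k E + lassomx k.+2 E.
Proof.
apply/matrixP => i j; rewrite !mxE.
transitivity (\sum_(t : k.+2.-tuple 'I_n | uniq t && (last i t == j)) weight R E i t).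
  rewrite (big_tuple_cons _ (fun t => uniq t && (last i t == j))) /=.
  by apply: eq_bigr => l _; rewrite !mxE mulr_sumr.
rewrite (bigID (fun t : k.+2.-tuple 'I_n => i \in (t : seq _))) /= addrC -addrA.
congr (_ + _).
  by apply: eq_bigl => t; rewrite andbAC [in RHS]/= [X in X && _]andbC.
rewrite (bigID (fun t : k.+2.-tuple 'I_n => i \in drop 2 t)) /= addrC.
congr (_ + _); last first.
  apply: eq_bigl => t; rewrite -andbA [X in _ && X]andb_idl 1?andbAC// => h.
  have : i \in take 2 t ++ drop 2 t by rewrite mem_cat h orbT.
  by rewrite cat_take_drop.
rewrite (big_tuple_cons _
  (fun t => uniq t && (last i t == j) && (i \in t) && (i \notin drop 2 t))
  (fun t => weight R E i t)).
(* In a backtracking walk [i, l, i, ...] the sign of the edge is squared to 1, leaving the weight of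
   the shorter path. The vertex [l] ranges over the [n - (k + 1)] vertices off that path. *)
transitivity (\sum_l \sum_(t : k.-tuple 'I_n | uniq (i :: t) && (last i t == j))
    (l \notin i :: t)%:R * weight R E i t).
  apply: eq_bigr => l _.
  rewrite (big_tuple_cons _ (fun t => uniq (l :: t) && (last l t == j) &&
    (i \in l :: t) && (i \notin drop 1 t)) (fun t => weight R E i (l :: t))).
  rewrite (bigD1 i)//= [X in _ + X]big1 ?addr0 => [|m mi].
    rewrite big_mkcond [RHS]big_mkcond; apply: eq_bigr => t _.
    rewrite drop0 /= !inE eqxx !orbT !andbT [edge l i]edgeC mulrA -expr2 edge_sign_sqr.
    rewrite !negb_or [l == i]eq_sym.
    by case: (i =P l); case: (l \in t); case: (i \in t); case: (uniq t); case: (_ == j);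
      rewrite //= ?mul0r.
  apply: big1 => t; rewrite drop0 !inE => /andP[/andP[_ +] it].
  rewrite (negbTE it) orbF [i == m]eq_sym (negbTE mi) orbF => /eqP->.
  by rewrite edge_signii mul0r.
rewrite exchange_big mulr_sumr; apply: eq_bigr => t /andP[ut _].
rewrite -mulr_suml -natr_sum; congr (_ * _).
have c := cardC (mem (i :: t)); rewrite (card_uniqP ut) /= size_tuple card_ord in c.
apply: (addrI (k.+1%:R)); rewrite [RHS]addrC subrK -natrD; congr (_%:R).
rewrite -[RHS]c -sum1_card [in RHS]big_mkcond; congr (_ + _)%N.
Qed.

End WalkMatrices.

(** * Chebyshev recurrence and traces *)
Section Frobenius.
Variable R : rcfType.

(** Lagrange's identity: the double sum of squares is twice the gap between the two sides. *)
Lemma sum_cauchy_schwarz (I : finType) (a b : I -> R) :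
  (\sum_i a i * b i) ^+ 2 <= (\sum_i a i ^+ 2) * (\sum_i b i ^+ 2).
Proof.
have : 0 <= \sum_i \sum_j (a i * b j - a j * b i) ^+ 2.
  by apply: sumr_ge0 => i _; apply: sumr_ge0 => j _; exact: sqr_ge0.
have e i : \sum_j (a i * b j - a j * b i) ^+ 2 = a i ^+ 2 * (\sum_j b j ^+ 2) +
    b i ^+ 2 * (\sum_j a j ^+ 2) - (a i * b i) * (2 * \sum_j a j * b j).
  rewrite mulrA !mulr_sumr -big_split -sumrB /=; apply: eq_bigr => j _; ring.
under eq_bigr do rewrite e.
by rewrite sumrB big_split /= -!mulr_suml; nra.
Qed.

Variable n : nat.
Implicit Types A B : 'M[R]_n.

Lemma fsq_ge0 A : 0 <= fsq A.
Proof. by apply: sumr_ge0 => i _; apply: sumr_ge0 => j _; exact: sqr_ge0. Qed.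

Lemma fsqZ c A : fsq (c *: A) = c ^+ 2 * fsq A.
Proof.
rewrite /fsq mulr_sumr; apply: eq_bigr => i _; rewrite mulr_sumr.
by apply: eq_bigr => j _; rewrite mxE exprMn.
Qed.

Lemma mul_scalemx c A B : A * (c *: B) = c *: (A * B).
Proof. by rewrite -!mulmxE -scalemxAr. Qed.

Lemma fsqN A : fsq (- A) = fsq A.
Proof. by rewrite -scaleN1r fsqZ sqrrN expr1n mul1r. Qed.

Lemma fsqD_le A B : fsq (A + B) <= 2 * (fsq A + fsq B).
Proof.
rewrite /fsq -big_split mulr_sumr; apply: ler_sum => i _ /=.
rewrite -big_split mulr_sumr; apply: ler_sum => j _ /=.
by rewrite mxE; have := sqr_ge0 (A i j - B i j); nra.
Qed.

Lemma fsqM_le A B : fsq (A *m B) <= fsq A * fsq B.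
Proof.
rewrite {1 2}/fsq mulr_suml; apply: ler_sum => i _.
rewrite /fsq exchange_big mulr_sumr; apply: ler_sum => j _.
by rewrite mxE; exact: sum_cauchy_schwarz.
Qed.

Lemma mxtrace_mul_le A B a b : fsq A <= a -> fsq B <= b ->
  `|\tr (A *m B)| <= Num.sqrt (a * b).
Proof.
move=> Aa Bb; have trE : \tr (A *m B) = \sum_(p : 'I_n * 'I_n) A p.1 p.2 * B p.2 p.1.
  rewrite -(pair_bigA _ (fun i j => A i j * B j i)) /=.
  by apply: eq_bigr => i _; rewrite mxE.
rewrite -sqrtr_sqr ler_wsqrtr// trE; apply: le_trans (sum_cauchy_schwarz _ _) _.
rewrite -(pair_bigA _ (fun i j => A i j ^+ 2)) -(pair_bigA _ (fun i j => B j i ^+ 2)) /=.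
by rewrite [X in _ * X]exchange_big ler_pM// fsq_ge0.
Qed.

End Frobenius.

(** * Traces of powers of [4 - w ^ 2] in an approximate Chebyshev recurrence *)

Section ChebyshevSystem.
Variable R : rcfType.

(* An approximate Chebyshev recurrence: with errors [r k] of bounded Frobenius
   norm, [q k] plays the role of the k-th Chebyshev polynomial of the second kind
   (for the semicircle law on [-2, 2]) evaluated at [w]. *)
Definition chebyshev_system (K : R) (L n : nat) (w : 'M[R]_n) (q r : nat -> 'M[R]_n) :=
  [/\ q 0 = 1, w * q 0 = q 1,
      forall k, (k < L)%N -> w * q k.+1 = q k.+2 + q k + r k.+1,
      forall k, (k <= L)%N -> fsq (q k) <= K * n%:R /\ fsq (r k) <= K
    & forall k, \tr (q k.+1) = 0].

(** Each factor [w] is absorbed by the recurrence, at the price of an error [w ^ a * r k], bounded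
    by submultiplicativity. The constant is fixed before the dimension and the matrices, which is
    what makes later estimates uniform. *)
Lemma fsq_pow_chebyshev (K : R) a k : 0 <= K -> exists2 C : R, 0 <= C &
  forall L n w q r, @chebyshev_system K L n w q r -> (a + k <= L)%N ->
    fsq (w ^+ a * q k) <= C * n%:R.
Proof.
move=> K0; elim: a k => [|a IHa] k.
  by exists K => // L n w q r [_ _ _ h _] /h[+ _]; rewrite expr0 mul1r.
have [C0 C00 h0] := IHa 0; case: k => [|k].
  have [C1 C10 h1] := IHa 1%N; exists C1 => // L n w q r sys aL.
  have [_ wq0 _ _ _] := sys; rewrite exprSr -mulrA wq0; apply: h1 sys _; lia.
have [C2 C20 h2] := IHa k.+2; have [C1 C10 h1] := IHa k.
exists (2 * (2 * (C2 + C1) + C0 * K)).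
  by rewrite !mulr_ge0// !(addr_ge0, mulr_ge0).
move=> L n w q r sys aL.
have [q0 _ wq bnd _] := sys; rewrite exprSr -mulrA wq; last by lia.
rewrite [X in fsq X]mulrDr [X in fsq (X + _)]mulrDr.
apply: le_trans (fsqD_le _ _) _; rewrite -mulrA ler_wpM2l// mulrDl.
apply: lerD.
  apply: le_trans (fsqD_le _ _) _; rewrite -mulrA ler_wpM2l// mulrDl.
  by apply: lerD; [apply: h2 sys _; lia | apply: h1 sys _; lia].
apply: le_trans (fsqM_le _ _) _; rewrite mulrAC ler_pM ?fsq_ge0//.
  by have := h0 _ _ _ _ _ sys; rewrite q0 mulr1; apply; lia.
by have [] := bnd k.+1; [lia|].
Qed.

Lemma fsq_edge_pow (K : R) b a : 0 <= K -> exists2 C : R, 0 <= C &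
  forall L n w q r, @chebyshev_system K L n w q r -> (b.*2 + a <= L)%N ->
    fsq ((4%:R - w ^+ 2) ^+ b * w ^+ a) <= C * n%:R.
Proof.
move=> K0; elim: b a => [|b IHb] a.
  have [C C0 h] := fsq_pow_chebyshev a 0 K0; exists C => // L n w q r sys aL.
  by have [q0 _ _ _ _] := sys; have := h _ _ _ _ _ sys; rewrite q0 mulr1 expr0 mul1r; apply; lia.
have [C1 C10 h1] := IHb a; have [C2 C20 h2] := IHb a.+2.
exists (2 * (4 ^+ 2 * C1 + C2)).
  by rewrite mulr_ge0// addr_ge0// mulr_ge0.
move=> L n w q r sys aL; rewrite exprSr -mulrA mulrBl mulrBr.
have -> : (4%:R : 'M[R]_n) * w ^+ a = 4 *: w ^+ a by rewrite mulr_natl scaler_nat.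
rewrite -exprD add2n; apply: le_trans (fsqD_le _ _) _.
rewrite -mulrA ler_wpM2l// mulrDl fsqN mul_scalemx fsqZ -mulrA.
by apply: lerD; [rewrite ler_wpM2l//; apply: h1 sys _; lia | apply: h2 sys _; lia].
Qed.

Lemma edge_chebyshev0 (K : R) L n w q r : @chebyshev_system K L n w q r -> (0 < L)%N ->
  (4%:R - w ^+ 2) * q 0%N = q 0%N *+ 3 - q 2%N - r 1%N.
Proof.
move=> [_ wq0 wq _ _] L0; rewrite mulrBl expr2 -mulrA wq0 wq// mulr_natl.
move: (q 0%N) (q 2%N) (r 1%N) => A B C; apply/matrixP => i j; rewrite !(mxE, mulmxnE); ring.
Qed.

Lemma edge_chebyshevS (K : R) L n w q r m : @chebyshev_system K L n w q r ->
  (m.+2 < L)%N -> (4%:R - w ^+ 2) * q m.+2 =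
  q m.+2 *+ 2 - q m.+4 - q m - (r m.+3 + r m.+1) - w * r m.+2.
Proof.
move=> [_ _ wq _ _] mL; rewrite mulrBl expr2 -mulrA wq; last by lia.
rewrite !mulrDr wq// wq; last by lia.
rewrite mulr_natl; move: (q m) (q m.+2) (q m.+4) (r m.+1) (r m.+3) (w * r m.+2).
by move=> A B C D F G; apply/matrixP => i j; rewrite !(mxE, mulmxnE); ring.
Qed.

Lemma bin_double_step b j : 'C(b.*2.+3, (b + j).+2)%:R =
  'C(b.*2.+1, b + j)%:R + 2 * 'C(b.*2.+1, (b + j).+1)%:R + 'C(b.*2.+1, (b + j).+2)%:R :> R.
Proof. by rewrite binS !(binS b.*2.+1) !natrD; ring. Qed.

(** Induction on [b] by [(4 - x^2) U_(2j) = 2 U_(2j) - U_(2j+2) - U_(2j-2)]. The sign [(-1) ^ j]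
    turns this into the double Pascal rule of [bin_double_step]. In the base case only [q 0] has a
    trace. The coefficient of [n] is the semicircle mean of [(4 - x^2)^b U_(2j)]. *)
Lemma mxtrace_edge_pow (K : R) b j : 0 <= K -> exists2 C : R, 0 <= C &
  forall L n w q r, @chebyshev_system K L n w q r -> (b.*2 + j.*2 < L)%N ->
    `|\tr ((4%:R - w ^+ 2) ^+ b * q j.*2) - (-1) ^+ j * 'C(b.*2.+1, (b + j).+1)%:R * n%:R|
    <= C * Num.sqrt n%:R.
Proof.
move=> K0; elim: b j => [|b IHb] j.
  exists 0 => // L n w q r [q0 _ _ _ trq] _; rewrite mul0r expr0 mul1r add0n.
  case: j => [|j]; first by rewrite q0 mxtrace1 mul1r bin1 mul1r subrr normr0.
  by rewrite doubleS trq bin_small// mulr0 mul0r subr0 normr0.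
have [C0 C00 h0] := fsq_edge_pow b 0 K0; have [C1 C10 h1] := fsq_edge_pow b 1 K0.
(* By Cauchy-Schwarz, a matrix with [fsq] of order [n] against an error with bounded [fsq] gives a
   trace of order [sqrt n]. *)
have err0 L n w q r m : @chebyshev_system K L n w q r -> (b.*2 < L)%N -> (m <= L)%N ->
    `|\tr ((4%:R - w ^+ 2) ^+ b * r m)| <= Num.sqrt (C0 * K) * Num.sqrt n%:R.
  move=> sys bL mL; rewrite -sqrtrM ?mulr_ge0// mulrAC.
  have [_ _ _ /(_ _ mL)[_ rm] _] := sys.
  apply: mxtrace_mul_le rm; have := h0 _ _ _ _ _ sys; rewrite mulr1; apply; lia.
have err1 L n w q r m : @chebyshev_system K L n w q r -> (b.*2 < L)%N -> (m <= L)%N ->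
    `|\tr ((4%:R - w ^+ 2) ^+ b * (w * r m))| <= Num.sqrt (C1 * K) * Num.sqrt n%:R.
  move=> sys bL mL; rewrite -sqrtrM ?mulr_ge0// mulrAC mulrA.
  have [_ _ _ /(_ _ mL)[_ rm] _] := sys.
  apply: mxtrace_mul_le rm; have := h1 _ _ _ _ _ sys; rewrite expr1; apply; lia.
case: j => [|j].
  have [A0 A00 a0] := IHb 0%N; have [A1 A10 a1] := IHb 1%N.
  exists (3 * A0 + A1 + Num.sqrt (C0 * K)).
    by rewrite !addr_ge0 ?sqrtr_ge0// mulr_ge0.
  move=> L n w q r sys bL.
  have [i0 i1 i2 i3] : [/\ (b.*2 < L)%N, (1 <= L)%N, (b.*2 + 0 < L)%N & (b.*2 + 2 < L)%N].
    by clear -bL; split; lia.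
  have {a0} := a0 _ _ _ _ _ sys; have {a1} := a1 _ _ _ _ _ sys.
  have {err0} := err0 _ _ _ _ _ 1%N sys.
  have -> : \tr ((4%:R - w ^+ 2) ^+ b.+1 * q 0.*2) =
      3 * \tr ((4%:R - w ^+ 2) ^+ b * q 0.*2) - \tr ((4%:R - w ^+ 2) ^+ b * q 2%N) -
      \tr ((4%:R - w ^+ 2) ^+ b * r 1%N).
    rewrite exprSr -mulrA (edge_chebyshev0 sys); last by clear -bL; lia.
    by rewrite !mulrBr mulrnAr !raddfB raddfMn /= mulr_natl.
  move=> he ha1 ha0; have {}he := he i0 i1.
  have {}ha0 := ha0 i2; have {}ha1 := ha1 i3.
  (* At [j = 0] the recurrence reflects: [U_(-2) = - U_0] raises the coefficient 2 to 3, matched by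
     the symmetry of the middle binomials. *)
  have -> : 'C(b.+1.*2.+1, (b.+1 + 0).+1)%:R =
      3 * 'C(b.*2.+1, b.+1)%:R + 'C(b.*2.+1, b.+2)%:R :> R.
    have := bin_double_step b 0; rewrite !addn0 doubleS => ->.
    have -> : 'C(b.*2.+1, b) = 'C(b.*2.+1, b.+1).
      by clear; rewrite -bin_sub; [congr binomial; lia|lia].
    by ring.
  move: he ha0 ha1; rewrite addn0 addn1 expr0 expr1 !ler_norml.
  by move=> /andP[? ?] /andP[? ?] /andP[? ?]; apply/andP; split; lra.
have [A0 A00 a0] := IHb j; have [A1 A10 a1] := IHb j.+1; have [A2 A20 a2] := IHb j.+2.
exists (2 * A1 + A2 + A0 + 2 * Num.sqrt (C0 * K) + Num.sqrt (C1 * K)).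
  by rewrite !addr_ge0 ?mulr_ge0 ?sqrtr_ge0.
move=> L n w q r sys bL.
have [i0 [i1 i2 i3] [i4 i5 i6]] : [/\ (b.*2 < L)%N,
  [/\ (j.*2.+1 <= L)%N, (j.*2.+2 <= L)%N & (j.*2.+3 <= L)%N] &
  [/\ (b.*2 + j.*2 < L)%N, (b.*2 + j.*2.+2 < L)%N & (b.*2 + j.*2.+4 < L)%N]].
  by clear -bL; split; [lia|split; lia|split; lia].
have {a0} := a0 _ _ _ _ _ sys; have {a1} := a1 _ _ _ _ _ sys.
have {a2} := a2 _ _ _ _ _ sys.
have := err0 _ _ _ _ _ j.*2.+1 sys; have := err0 _ _ _ _ _ j.*2.+3 sys.
have {err1} := err1 _ _ _ _ _ j.*2.+2 sys.
have -> : \tr ((4%:R - w ^+ 2) ^+ b.+1 * q j.+1.*2) =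
    2 * \tr ((4%:R - w ^+ 2) ^+ b * q j.*2.+2) - \tr ((4%:R - w ^+ 2) ^+ b * q j.*2.+4) -
    \tr ((4%:R - w ^+ 2) ^+ b * q j.*2) - (\tr ((4%:R - w ^+ 2) ^+ b * r j.*2.+3) +
    \tr ((4%:R - w ^+ 2) ^+ b * r j.*2.+1)) -
    \tr ((4%:R - w ^+ 2) ^+ b * (w * r j.*2.+2)).
  rewrite exprSr -mulrA doubleS (edge_chebyshevS sys); last by clear -bL; lia.
  by rewrite !mulrBr mulrnAr mulrDr !raddfB raddfMn raddfD /= mulr_natl.
rewrite !doubleS.
move=> e1 e2 e3 ha2 ha1 ha0; have {}e1 := e1 i0 i2.
have {}e2 := e2 i0 i3; have {}e3 := e3 i0 i1.
have {}ha0 := ha0 i4; have {}ha1 := ha1 i5; have {}ha2 := ha2 i6.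
move: e1 e2 e3 ha0 ha1 ha2; rewrite addSn bin_double_step !addnS !exprS.
rewrite !ler_norml.
move=> /andP[? ?] /andP[? ?] /andP[? ?] /andP[? ?] /andP[? ?] /andP[? ?].
by apply/andP; split; lra.
Qed.

End ChebyshevSystem.

(** * Spectral majorization *)
Section Spectral.
Variable R : rcfType.
Local Open Scope complex_scope.

(** For symmetric [M] this bounds the spectral norm by [s]. *)
Definition quadform_le n (s : R) (M : 'M[R]_n) := forall x : 'I_n -> R,
  `|\sum_i \sum_j M i j * (x i * x j)| <= s * \sum_i x i ^+ 2.

Lemma conjCE (z : R[i]) : Num.conj z = conjc z.
Proof. by []. Qed.

Lemma Re_sum (I : Type) (r : seq I) (F : I -> R[i]) :
  complex.Re (\sum_(i <- r) F i) = \sum_(i <- r) complex.Re (F i).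
Proof. by apply: big_morph => // -[x y] [z t]. Qed.

Lemma natmxE (K : pzRingType) n k : (k%:R : 'M[K]_n) = k%:R%:M.
Proof. by rewrite raddfMn. Qed.

(** The [d i] are the eigenvalues of [W], from a unitary diagonalisation over the complex numbers.
    The real and imaginary parts of a unit eigenvector serve as two real test vectors for [M]; their
    squared norms add up to 1. *)
Lemma spectral_trace n (W : 'M[R]_n) : W^T = W -> exists d : 'I_n -> R,
  (forall s M, quadform_le s M -> \tr (W *m M) <= s * \sum_i `|d i|) /\
  (forall b, \tr ((4%:R - W ^+ 2) ^+ b) = \sum_i (4 - d i ^+ 2) ^+ b).
Proof.
move=> Wsym; pose WC := map_mx (real_complex R) W.
have Wherm : WC \is hermsymmx.
  apply: realsym_hermsym.
    by apply/is_hermitianmxP; apply/matrixP => i j; rewrite !mxE mul1r -{1}Wsym mxE.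
  by apply/mxOverP => i j; rewrite mxE complex_real.
have /hermitian_normalmx/orthomx_spectralP WE := Wherm.
have /mxOverP dreal := hermitian_spectral_diag_real Wherm.
set P := spectralmx WC in WE; set sd := spectral_diag WC in WE dreal.
have PU : P \is unitarymx := spectral_unitarymx WC.
have sdE i : sd 0 i = (complex.Re (sd 0 i))%:C by rewrite RRe_real.
exists (fun i => complex.Re (sd 0 i)); split.
  move=> s M Ms.
  pose a k i := complex.Re (P k i); pose b k i := complex.Im (P k i).
  have Wij i j : W i j = \sum_k complex.Re (sd 0 k) * (a k i * a k j + b k i * b k j).
    have /(congr1 (fun A : 'M[R[i]]_n => complex.Re (A i j))) := WE.
    rewrite invmx_unitary// !mxE /= => ->.
    rewrite Re_sum /=.
    apply: eq_bigr => k _; rewrite mul_mx_diag !mxE sdE conjCE /a /b.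
    by case: (P k i) => x y; case: (P k j) => z t /=; ring.
  have norm1 k : \sum_i (a k i ^+ 2 + b k i ^+ 2) = 1.
    have /unitarymxP/matrixP/(_ k k) := PU; rewrite !mxE eqxx /=.
    move=> /(congr1 (@complex.Re R)); rewrite Re_sum /= => <-.
    apply: eq_bigr => i _; rewrite !mxE conjCE /a /b.
    by case: (P k i) => x y /=; ring.
  have -> : \tr (W *m M) = \sum_k complex.Re (sd 0 k) *
     (\sum_i \sum_j M i j * (a k i * a k j) + \sum_i \sum_j M i j * (b k i * b k j)).
    rewrite /mxtrace; under eq_bigr => i _ do rewrite mxE.
    under eq_bigr => i _ do under eq_bigr => j _ do rewrite Wij mulr_suml.
    under eq_bigr do rewrite exchange_big.
    rewrite exchange_big; apply: eq_bigr => k _.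
    rewrite exchange_big -big_split mulr_sumr; apply: eq_bigr => i _ /=.
    rewrite -big_split mulr_sumr; apply: eq_bigr => j _ /=; ring.
  rewrite mulr_sumr; apply: ler_sum => k _; apply: le_trans (ler_norm _) _.
  rewrite normrM mulrC ler_wpM2r//.
  apply: le_trans (ler_normD _ _) _; apply: le_trans (lerD (Ms _) (Ms _)) _.
  by rewrite -mulrDr -big_split norm1 mulr1.
move=> b; pose D := diag_mx (\row_i (4 - complex.Re (sd 0 i) ^+ 2)%:C).
have PK : P *m invmx P = 1%:M by rewrite mulmxV// spectral_unit.
have PK' : invmx P *m P = 1%:M by rewrite mulVmx// spectral_unit.
have base : map_mx (real_complex R) (4%:R - W ^+ 2) = invmx P *m D *m P.
  have -> : D = 4%:R - diag_mx sd *m diag_mx sd.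
    rewrite natmxE; apply/matrixP => i j; rewrite mul_diag_mx !mxE.
    case: eqVneq => [->|ij].
      rewrite !mulr1n rmorphB rmorphXn /= -sdE -expr2; congr (_ - _).
      by rewrite rmorph_nat.
    by rewrite !mulr0n mulr0 subr0.
  rewrite mulmxBr mulmxBl map_mxB; congr (_ - _).
    rewrite !natmxE -[X in _ *m X *m _]scalemx1 -scalemxAr mulmx1 -scalemxAl PK'.
    by rewrite scalemx1 map_scalar_mx rmorph_nat.
  rewrite expr2 map_mxM -/WC {1}WE {1}WE -!mulmxA; congr (_ *m (_ *m _)).
  by rewrite mulKVmx ?spectral_unit.
have pol m : map_mx (real_complex R) ((4%:R - W ^+ 2) ^+ m) = invmx P *m D ^+ m *m P.
  elim: m => [|m IHm]; first by rewrite !expr0 mulmx1 PK' map_mx1.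
  rewrite ![_ ^+ m.+1]exprS map_mxM IHm base -!mulmxA; congr (_ *m (_ *m _)).
  by rewrite mulKVmx ?spectral_unit.
have Dpow m : D ^+ m = diag_mx (\row_i ((4 - complex.Re (sd 0 i) ^+ 2) ^+ m)%:C).
  elim: m => [|m IHm].
    apply/matrixP => i j; rewrite !mxE expr0 rmorph1.
    by [].
  rewrite exprS IHm; apply/matrixP => i j; rewrite -[D * _]/(D *m _) mul_diag_mx !mxE.
  by rewrite mulrnAr [_ ^+ m.+1]exprS rmorphM.
apply: (@complexI R); rewrite -trace_map_mx pol mxtrace_mulC mulmxA PK mul1mx Dpow.
by rewrite mxtrace_diag rmorph_sum; apply: eq_bigr => i _; rewrite mxE.
Qed.

End Spectral.

(** * Wallis ratios and the polynomial majorant of the absolute value *)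
Section Wallis.
Variable R : realType.

Lemma derive_ge0_le (f df : R -> R) (a b : R) : a <= b ->
  (forall x, a <= x <= b -> is_derive x 1 f (df x)) ->
  (forall x, a <= x <= b -> 0 <= df x) -> f a <= f b.
Proof.
move=> ab fd df0; rewrite -subr_ge0.
have [x x_||c + ->] := @MVT_segment _ f df a b ab.
- by apply: fd; move: x_; rewrite in_itv /= => /andP[/ltW-> /ltW->].
- apply: derivable_within_continuous => x; rewrite in_itv /= => /fd h.
  exact: ex_derive.
- by rewrite in_itv /= => /df0 c0; rewrite mulr_ge0// subr_ge0.
Qed.

(** This is [C(2k, k) / 4 ^ k]. *)
Fixpoint wallis k : R :=
  if k is k'.+1 then wallis k' * k'.*2.+1%:R / k'.*2.+2%:R else 1.

Lemma wallis_gt0 k : 0 < wallis k.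
Proof. by elim: k => //= k IH; rewrite !mulr_gt0 ?invr_gt0 ?ltr0n. Qed.

Lemma wallis_bin k : 'C(k.*2.+1, k.+1)%:R / 4 ^+ k = k.*2.+1%:R / k.+1%:R * wallis k.
Proof.
elim: k => [|k IHk]; first by rewrite bin1 /= expr0; field.
have h : (k.+2 * 'C(k.*2.+3, k.+2) = k.*2.+3 * (2 * 'C(k.*2.+1, k.+1)))%N.
  rewrite -mul_bin_diag -[_.-1]/(k.*2.+2) (binS k.*2.+1 k); congr (_ * _)%N.
  have -> : 'C(k.*2.+1, k) = 'C(k.*2.+1, k.+1).
    by rewrite -bin_sub; [congr binomial; lia|lia].
  by rewrite addnn mul2n.
have {h} : k.+2%:R * 'C(k.*2.+3, k.+2)%:R = k.*2.+3%:R * (2 * 'C(k.*2.+1, k.+1)%:R) :> R.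
  by rewrite -!natrM h.
rewrite doubleS /= exprS => h.
have k0 : k.*2.+2%:R = 2 * k.+1%:R :> R by rewrite -natrM mul2n -doubleS.
have -> : 'C(k.*2.+3, k.+2)%:R = k.*2.+3%:R * (2 * 'C(k.*2.+1, k.+1)%:R) / k.+2%:R :> R.
  by rewrite -h mulrAC mulfV ?mul1r// pnatr_eq0.
transitivity (k.*2.+3%:R * 2 / k.+2%:R / 4 * ('C(k.*2.+1, k.+1)%:R / 4 ^+ k) : R).
  by rewrite invfM; ring.
rewrite IHk k0; field.
by rewrite !gt_eqF ?ltr_pwDl ?ler0n ?ltr0n.
Qed.

(** Antiderivative of [sin ^ n] given by the reduction formula; [sin_intv] below is the Wallis
    integral over [[0, pi / 2]]. *)
Fixpoint sin_int n (x : R) : R := match n with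
  | 0 => x
  | n1.+1 => match n1 with
    | 0 => - cos x
    | n'.+1 => (n'.+1%:R * sin_int n' x - sin x ^+ n1 * cos x) / n1.+1%:R
    end
  end.

Lemma is_derive_sin_int n (x : R) : is_derive x 1 (sin_int n) (sin x ^+ n).
Proof.
elim/ltn_ind: n => -[|[|n]] IHn; first by rewrite expr0; exact: is_derive_id.
  by rewrite expr1 -[sin x]opprK; exact: is_deriveN.
have Jn := IHn n (ltnW (ltnSn _)).
have -> : sin_int n.+2 = n.+2%:R^-1 *: (n.+1%:R *: sin_int n - sin ^+ n.+1 * cos).
  by apply/funext => y; rewrite !fctE /= [RHS]mulrC.
apply: is_derive_eq; rewrite exprfctE /GRing.scale /=.
transitivity (n.+2%:R^-1 * (n.+1%:R * sin x ^+ n * (1 - cos x ^+ 2) + sin x ^+ n * sin x ^+ 2)).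
  by rewrite (exprS _ n); ring.
rewrite cos2sin2 -[n.+2]addn2 exprD natrD -[n.+1%:R]natr1; field.
by rewrite gt_eqF// ltr_pwDl.
Qed.

Definition sin_intv n : R := sin_int n (pi / 2) - sin_int n 0.

Lemma sin_intvSS n : sin_intv n.+2 = n.+1%:R / n.+2%:R * sin_intv n.
Proof.
rewrite /sin_intv /= cos_pihalf sin0 expr0n /= mulr0 mul0r !subr0.
by rewrite -mulrBl -mulrBr mulrAC.
Qed.

Lemma sin_intv_le n : sin_intv n.+1 <= sin_intv n.
Proof.
have pi0 : 0 <= pi / 2 :> R by rewrite divr_ge0// pi_ge0.
have := @derive_ge0_le (sin_int n - sin_int n.+1) (fun x => sin x ^+ n - sin x ^+ n.+1) _ _ pi0.
rewrite /sin_intv !fctE => h.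
suff : sin_int n 0 - sin_int n.+1 0 <= sin_int n (pi / 2) - sin_int n.+1 (pi / 2) by lra.
apply: h => x x_; first by apply: is_deriveB; exact: is_derive_sin_int.
rewrite exprS -{1}[_ ^+ n]mul1r -mulrBl mulr_ge0 ?exprn_ge0 ?subr_ge0 ?sin_le1//.
have pi1 := pi_gt0 R.
by apply: sin_ge0_pi; move: x_ pi1; lra.
Qed.

Lemma sin_intv_even k : sin_intv k.*2 = pi / 2 * wallis k.
Proof.
elim: k => [|k IHk]; first by rewrite /sin_intv/= subr0 mulr1.
by rewrite doubleS sin_intvSS IHk /=; ring.
Qed.

Lemma sin_intv_odd k : sin_intv k.*2.+1 = (k.*2.+1%:R * wallis k)^-1.
Proof.
elim: k => [|k IHk]; first by rewrite /sin_intv/= cos_pihalf cos0 mulr1 invr1; ring.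
rewrite doubleS sin_intvSS IHk /= -mulrA.
have := wallis_gt0 k; move: (wallis k) => u u0.
rewrite !invfM !invrK.
have : k.*2.+1%:R != 0 :> R by rewrite pnatr_eq0.
have : k.*2.+2%:R != 0 :> R by rewrite pnatr_eq0.
have : k.*2.+3%:R != 0 :> R by rewrite pnatr_eq0.
move: (k.*2.+1%:R) (k.*2.+2%:R) (k.*2.+3%:R) => a b c c0 b0 a0.
by field; rewrite a0 c0 gt_eqF.
Qed.

Lemma wallis_le m : (0 < m)%N -> wallis m ^+ 2 <= (pi * m%:R)^-1.
Proof.
case: m => // k _.
have := sin_intv_le k.*2.+1; rewrite -doubleS sin_intv_even sin_intv_odd.
have u0 := wallis_gt0 k; have u1 := wallis_gt0 k.+1; have pi0 := pi_gt0 R.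
(* Both the even and the odd integral are now expressed by [wallis k.+1], and their comparison
   bounds its square. *)
have -> : k.*2.+1%:R * wallis k = 2 * k.+1%:R * wallis k.+1.
  rewrite /= -natrM mul2n doubleS mulrCA mulfV ?pnatr_eq0//.
  by rewrite mulr1 mulrC.
have k0 : 0 < k.+1%:R :> R by rewrite ltr0n.
move=> le0; have le1 : pi / 2 * wallis k.+1 * (2 * k.+1%:R * wallis k.+1) <= 1.
  by rewrite -ler_pdivlMr ?div1r// !mulr_gt0.
rewrite -[leRHS]mul1r ler_pdivlMr ?mulr_gt0//.
by apply: le_trans le1; rewrite le_eqVlt; apply/orP; left; apply/eqP; field.
Qed.

End Wallis.

(** * Polynomial majorant of the absolute value and its semicircle mean *)

Section AbsoluteValueMajorant.
Variable R : realType.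

(* Taylor polynomial of [sqrt (1 - t)] at [0], of degree [m]. *)
Definition sqrt_taylor m (t : R) : R :=
  1 - \sum_(k < m) wallis R k / k.*2.+2%:R * t ^+ k.+1.

Lemma sqrt_taylorS m t :
  sqrt_taylor m.+1 t = sqrt_taylor m t - wallis R m / m.*2.+2%:R * t ^+ m.+1.
Proof. by rewrite /sqrt_taylor big_ord_recr opprD addrA. Qed.

Lemma natr_double2 m : m.*2.+2%:R = 2 * m.+1%:R :> R.
Proof. by rewrite -natrM mul2n -doubleS. Qed.

Lemma natr_double1 m : m.*2.+1%:R = 2 * m.+1%:R - 1 :> R.
Proof. by rewrite -natr_double2 -[in RHS]natr1 addrK. Qed.

Lemma sqrt_taylor1 m : sqrt_taylor m 1 = wallis R m.
Proof.
elim: m => [|m IHm]; first by rewrite /sqrt_taylor big_ord0 subr0.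
rewrite sqrt_taylorS IHm expr1n /= natr_double1 natr_double2; field.
by rewrite addrC natr1 pnatr_eq0.
Qed.

(** In [t = 1 - y^2] with [y > 0] the function [sqrt (1 - t)] is [y], a solution of [y f' = f]. The
    truncated series solves this equation up to the single term [wallis m * t ^ m]. *)
Lemma is_derive_sqrt_taylor m (y : R) : y != 0 ->
  is_derive y 1 (fun z => sqrt_taylor m (1 - z ^+ 2))
    ((sqrt_taylor m (1 - y ^+ 2) - wallis R m * (1 - y ^+ 2) ^+ m) / y).
Proof.
move=> y0; elim: m => [|m IHm].
  rewrite /sqrt_taylor big_ord0 subr0 expr0 mulr1 subrr mul0r.
  have -> : (fun z : R => 1 - \sum_(k < 0) wallis R k / k.*2.+2%:R * (1 - z ^+ 2) ^+ k.+1) = cst 1.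
    by apply/funext => z; rewrite big_ord0 subr0.
  exact: is_derive_cst.
have -> : (fun z => sqrt_taylor m.+1 (1 - z ^+ 2)) =
    (fun z => sqrt_taylor m (1 - z ^+ 2)) -
    (wallis R m / m.*2.+2%:R) *: ((cst 1 - id ^+ 2 : R -> R) ^+ m.+1).
  by apply/funext => z; rewrite !fctE sqrt_taylorS.
apply: is_derive_eq; rewrite sqrt_taylorS !fctE /GRing.scale /=.
set s := sqrt_taylor m _; set t := 1 - y ^+ 2.
rewrite ![t ^+ m.+1]exprS natr_double1 natr_double2 expr1; move: (t ^+ m) => p.
by rewrite /t; field; rewrite y0 addrC natr1 pnatr_eq0.
Qed.

(** The quotient of the right side by [y] has derivative [- wallis m * (1 - y^2)^m / y^2]. For odd
    [m] it decreases up to [y = 1] and increases afterwards, so its minimum is its value 1 there.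
    Covering [y > 1] spares any bound on the largest eigenvalue. *)
Lemma sqrt_taylor_ge m (y : R) : odd m -> 0 <= y -> y <= sqrt_taylor m (1 - y ^+ 2).
Proof.
move=> om; rewrite le_eqVlt => /orP[/eqP<-|y0].
  by rewrite expr0n /= subr0 sqrt_taylor1 ltW// wallis_gt0.
pose f : R -> R := (fun z => sqrt_taylor m (1 - z ^+ 2)) * (fun z => z^-1).
pose df (z : R) : R := - (wallis R m * (1 - z ^+ 2) ^+ m / z ^+ 2).
have fd (z : R) : 0 < z -> is_derive z 1 f (df z).
  move=> z0; have zn0 : z != 0 by rewrite gt_eqF.
  have h := is_derive_sqrt_taylor m zn0.
  have hV : is_derive z 1 (fun x : R => x^-1) (- z ^- 2 * 1).
    exact: (is_deriveV zn0 (is_derive_id z 1)).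
  apply: is_derive_eq; rewrite /df /GRing.scale /= mulr1.
  by field.
have f1 : f 1 = 1.
  rewrite /f !fctE expr1n subrr invr1 mulr1 /sqrt_taylor big1 ?subr0// => i _.
  by rewrite expr0n mulr0.
suff : 1 <= f y by rewrite /f !fctE ler_pdivlMr// mul1r.
have u0 := wallis_gt0 R m.
rewrite -f1; case: (leP y 1) => y1.
  rewrite -lerN2; apply: (@derive_ge0_le _ (- f) (- df) _ _ y1) => z /andP[yz z1].
    by apply: is_deriveN; apply: fd; apply: lt_le_trans yz.
  rewrite !fctE /df opprK !mulr_ge0 ?(ltW u0)// ?invr_ge0 ?sqr_ge0// exprn_ge0// subr_ge0.
  by rewrite expr_le1// (le_trans (ltW y0)).
apply: (@derive_ge0_le _ f df _ _ (ltW y1)) => z /andP[z1 zy].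
  by apply: fd; apply: lt_le_trans z1.
rewrite /df -mulNr -mulrN mulr_ge0 ?invr_ge0 ?sqr_ge0// mulr_ge0 ?(ltW u0)//.
rewrite oppr_ge0 -[m]odd_double_half om add1n [_ ^+ (_.*2).+1]exprS.
apply: mulr_le0_ge0; first by rewrite subr_le0 expr_ge1// (le_trans _ z1).
by rewrite -mul2n exprM exprn_ge0// sqr_ge0.
Qed.

Lemma normr_le_sqrt_taylor m (x : R) : odd m -> `|x| <= 2 * sqrt_taylor m ((4 - x ^+ 2) / 4).
Proof.
move=> om; have := sqrt_taylor_ge om (_ : 0 <= `|x| / 2).
rewrite divr_ge0// => /(_ isT); rewrite expr_div_n real_normK ?num_real//.
by rewrite (_ : 1 - x ^+ 2 / 2 ^+ 2 = (4 - x ^+ 2) / 4); [lra | field].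
Qed.

(** The polynomial [sqrt_taylor m ((4 - x^2) / 4)] with each power of [4 - x^2] replaced by its
    semicircle mean. *)
Definition semicircle_sqrt_taylor m : R := 1 - \sum_(k < m) wallis R k / k.*2.+2%:R *
  ('C(k.+1.*2.+1, k.+2)%:R / 4 ^+ k.+1).

(** The partial sums telescope. The closed form behaves like [4 m / 3] times the squared Wallis
    ratio, so it tends to [4 / (3 pi)]. *)
Lemma semicircle_sqrt_taylorE m : semicircle_sqrt_taylor m =
  m.*2.+1%:R * m.*2.+3%:R / (3 * m.+1%:R) * wallis R m ^+ 2.
Proof.
rewrite /semicircle_sqrt_taylor; elim: m => [|m IHm].
  by rewrite big_ord0 subr0 [wallis R 0]/= expr1n double0 mul1r !mulr1 divff.
rewrite big_ord_recr opprD addrA IHm wallis_bin doubleS /=.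
have -> : m.*2.+1%:R = 2 * m%:R + 1 :> R by rewrite -natrM mul2n natr1.
have -> : m.*2.+2%:R = 2 * m%:R + 2 :> R by rewrite -natrM mul2n -natrD addn2.
have -> : m.*2.+3%:R = 2 * m%:R + 3 :> R by rewrite -natrM mul2n -natrD addn3.
have -> : m.*2.+4.+1%:R = 2 * m%:R + 5 :> R by rewrite -natrM mul2n -natrD addnC.
have -> : m.+1%:R = m%:R + 1 :> R by rewrite natr1.
have -> : m.+2%:R = m%:R + 2 :> R by rewrite -natrD addn2.
have := ler0n R m; move: (m%:R : R) => x x0; field.
by rewrite !gt_eqF//; lra.
Qed.

Lemma semicircle_sqrt_taylor_le m : (0 < m)%N ->
  2 * semicircle_sqrt_taylor m <= 8 / (3 * pi) + 2 / m%:R.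
Proof.
move=> m0; rewrite semicircle_sqrt_taylorE.
have pi2 := pi_ge2 R; have mp : 0 < m%:R :> R by rewrite ltr0n.
apply: le_trans (_ : 2 * (m.*2.+1%:R * m.*2.+3%:R / (3 * m.+1%:R) / (pi * m%:R)) <= _).
  by rewrite ler_wpM2l// ler_wpM2l ?wallis_le// divr_ge0// mulr_ge0.
have -> : m.*2.+1%:R = 2 * m%:R + 1 :> R by rewrite -natrM mul2n natr1.
have -> : m.*2.+3%:R = 2 * m%:R + 3 :> R by rewrite -natrM mul2n -natrD addn3.
have -> : m.+1%:R = m%:R + 1 :> R by rewrite natr1.
move: (m%:R : R) mp (pi : R) pi2 => x x0 p p2.
rewrite -subr_ge0.
have -> : 8 / (3 * p) + 2 / x - 2 * ((2 * x + 1) * (2 * x + 3) / (3 * (x + 1)) / (p * x)) =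
  (6 * p * (x + 1) - 8 * x - 6) / (3 * p * x * (x + 1)).
  by field; rewrite !gt_eqF//; lra.
by rewrite divr_ge0 ?mulr_ge0//; nra.
Qed.

End AbsoluteValueMajorant.

(** * Nuclear norm and duality *)
Section NuclearNorm.
Variable R : realType.

Definition nuc n (W : 'M[R]_n) : R := sup [set \tr (W *m M) | M in quadform_le 1].

Section Sup.
Variables (n : nat) (W : 'M[R]_n).
Hypothesis Wsym : W^T = W.

Lemma nuc_has_sup : has_sup [set \tr (W *m M) | M in quadform_le 1].
Proof.
split.
  exists (\tr (W *m 0)); exists 0 => // x.
  rewrite big1 => [|i _]; last by rewrite big1// => j _; rewrite mxE mul0r.
  by rewrite normr0 mul1r sumr_ge0// => i _; exact: sqr_ge0.
have [d [dM _]] := spectral_trace Wsym.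
by exists (1 * \sum_i `|d i|) => _ [M M1 <-]; exact: dM.
Qed.

Lemma mxtrace_le_nuc s (M : 'M[R]_n) : 0 < s -> quadform_le s M -> \tr (W *m M) <= s * nuc W.
Proof.
move=> s0 Ms; have h : \tr (W *m (s^-1 *: M)) <= nuc W.
  apply: sup_upper_bound; first exact: nuc_has_sup.
  exists (s^-1 *: M) => // x.
  have -> : \sum_i \sum_j (s^-1 *: M) i j * (x i * x j) =
      s^-1 * \sum_i \sum_j M i j * (x i * x j).
    rewrite mulr_sumr; apply: eq_bigr => i _; rewrite mulr_sumr.
    by apply: eq_bigr => j _; rewrite mxE -mulrA.
  by rewrite normrM gtr0_norm ?invr_gt0// ler_pdivrMl// mul1r.
by move: h; rewrite -scalemxAr linearZ /= ler_pdivrMl.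
Qed.

Lemma nuc_le b : (forall M, quadform_le 1 M -> \tr (W *m M) <= b) -> nuc W <= b.
Proof.
by move=> h; apply: sup_le_ub; [case: nuc_has_sup|move=> _ [M M1 <-]; exact: h].
Qed.

Lemma nuc_ge0 : 0 <= nuc W.
Proof.
have : \tr (W *m 0) <= 1 * nuc W.
  apply: mxtrace_le_nuc => // x.
  rewrite big1 => [|i _]; last by rewrite big1// => j _; rewrite mxE mul0r.
  by rewrite normr0 mul1r sumr_ge0// => i _; exact: sqr_ge0.
by rewrite mulmx0 mxtrace0 mul1r.
Qed.

End Sup.

Lemma quadform_le_sigma1 n (M : 'M[R]_n) : quadform_le (sigma1 M) M.
Proof.
have vn (x : 'cV[R]_n) : vnorm x ^+ 2 = \sum_i x i 0 ^+ 2.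
  by rewrite sqr_sqrtr// sumr_ge0// => i _; exact: sqr_ge0.
have vn0 (x : 'cV[R]_n) : 0 <= vnorm x by exact: sqrtr_ge0.
(* The Frobenius norm shows that the set whose supremum is [sigma1 M] is bounded. *)
have Mx (x : 'cV[R]_n) : vnorm (M *m x) <= Num.sqrt (fsq M) * vnorm x.
  rewrite /vnorm -sqrtrM ?fsq_ge0// ler_wsqrtr// mulr_suml; apply: ler_sum => i _.
  by rewrite mxE; exact: sum_cauchy_schwarz.
have vZ c (x : 'cV[R]_n) : 0 <= c -> vnorm (c *: x) = c * vnorm x.
  move=> c0; rewrite /vnorm -{2}(ger0_norm c0) -sqrtr_sqr -sqrtrM ?sqr_ge0// mulr_sumr.
  by congr Num.sqrt; apply: eq_bigr => i _; rewrite mxE exprMn.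
have Msigma (x : 'cV[R]_n) : vnorm (M *m x) <= sigma1 M * vnorm x.
  (* A zero vector cannot be normalised; this case also covers [n = 0], where no unit vector
     exists. *)
  have [x0|x0] := eqVneq (vnorm x) 0.
    by rewrite x0 mulr0; have := Mx x; rewrite x0 mulr0.
  have xp : 0 < vnorm x by rewrite lt_neqAle eq_sym x0 vn0.
  rewrite -ler_pdivrMr// mulrC -vZ ?invr_ge0// scalemxAr.
  apply: sup_upper_bound; last first.
    by exists ((vnorm x)^-1 *: x) => //=; rewrite vZ ?invr_ge0// mulVf.
  split; first by exists (vnorm (M *m ((vnorm x)^-1 *: x))), ((vnorm x)^-1 *: x) => //=;
    rewrite vZ ?invr_ge0// mulVf.
  by exists (Num.sqrt (fsq M)) => _ [y /= y1 <-]; have := Mx y; rewrite y1 mulr1.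
move=> x; pose X : 'cV[R]_n := \col_i x i.
have -> : \sum_i \sum_j M i j * (x i * x j) = \sum_i X i 0 * (M *m X) i 0.
  apply: eq_bigr => i _; rewrite !mxE mulr_sumr.
  by apply: eq_bigr => j _; rewrite !mxE; ring.
have -> : \sum_i x i ^+ 2 = vnorm X ^+ 2 by rewrite vn; apply: eq_bigr => i _; rewrite mxE.
apply: le_trans (_ : vnorm X * vnorm (M *m X) <= _).
  rewrite -sqrtr_sqr -sqrtrM; last by rewrite sumr_ge0// => i _; exact: sqr_ge0.
  by rewrite ler_wsqrtr// sum_cauchy_schwarz.
by rewrite expr2 mulrCA ler_wpM2l.
Qed.

(** * The dual certificate and the effect of a single edge on its nuclear norm *)

Section Graph.
Import mathcomp.boot.fintype mathcomp.boot.finset.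
Variable n : nat.
Implicit Types (E : {set 'I_n * 'I_n}).

Lemma signmx_sym E : (signmx R E)^T = signmx R E.
Proof. by apply/matrixP => i j; rewrite !mxE edgeC. Qed.

Lemma edge_sign_pairs_lt E i j : E \subset pairs_lt n -> i != j ->
  edge_sign R E (edge i j) + 1 = 2 * (((i, j) \in E)%:R + ((j, i) \in E)%:R).
Proof.
move=> /subsetP EP ij; rewrite /edge_sign.
have nE (a b : 'I_n) : (b <= a)%N -> (a, b) \in E = false.
  by move=> ba; apply/negP => /EP; rewrite inE /= ltnNge ba.
have h (a b : 'I_n) : (a < b)%N ->
    (if (a, b).1 == (a, b).2 then 0 else (-1) ^+ ((a, b) \notin E)) + 1 =
    2 * (((a, b) \in E)%:R + ((b, a) \in E)%:R) :> R.
  move=> ab; rewrite (nE b a (ltnW ab)) /= -val_eqE (ltn_eqF ab) addr0.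
  by case: ((a, b) \in E) => /=; [rewrite expr0 | rewrite expr1]; ring.
rewrite /edge; case: ltngtP => ij'; first exact: h.
  by rewrite h// addrC.
by case/eqP: ij; exact: val_inj.
Qed.

(** Off the diagonal [W + J] is twice the adjacency matrix, the diagonal of [M] vanishes, and [M] is
    1 on both orientations of each edge. *)
Lemma admissible_duality E (M : 'M[R]_n) : E \subset pairs_lt n -> admissible E M ->
  4 * #|E|%:R = \tr (signmx R E *m M) + \sum_i \sum_j M i j.
Proof.
move=> EP [Msym [M0 ME]].
have cE : \sum_i \sum_j ((i, j) \in E)%:R = #|E|%:R :> R.
  rewrite pair_bigA -sum1_card natr_sum [RHS]big_mkcond.
  by apply: eq_bigr => -[i j] _ /=; case: (_ \in E).
have -> : 4 * #|E|%:R = 2 * (#|E|%:R + #|E|%:R) :> R by ring.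
rewrite -{1}cE exchange_big -{1}cE -big_split mulr_sumr /mxtrace -big_split /=.
apply: eq_bigr => i _; rewrite mxE -!big_split mulr_sumr /=; apply: eq_bigr => j _.
rewrite mxE; have Mij : M j i = M i j by rewrite -{1}Msym mxE.
rewrite Mij -{2}[M i j]mul1r -mulrDl.
have [->|ij] := eqVneq i j.
  rewrite M0 mulr0; have -> : (j, j) \in E = false.
    by apply/negP => /(subsetP EP); rewrite inE /= ltnn.
  by rewrite addr0 mulr0.
rewrite edge_sign_pairs_lt//.
case: (boolP ((i, j) \in E)) => [/ME->|_]; first by rewrite mulr1 addrC.
case: (boolP ((j, i) \in E)) => [/ME|_]; first by rewrite Mij => ->; rewrite mulr1 addrC.
by rewrite addr0 mulr0 mul0r.
Qed.

Lemma rho_bar_ge_nuc E c : (0 < n)%N -> E \subset pairs_lt n -> 0 < c ->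
  c * (n%:R + nuc (signmx R E)) <= 4 * #|E|%:R -> rho_bar_ge E c.
Proof.
move=> n0 EP c0 cE M adm; rewrite leNgt; apply/negP => sc.
(* The maximum with [c / 2] makes [s] positive, as [mxtrace_le_nuc] demands, while keeping it below
   [c]. *)
pose s := Num.max (sigma1 M) (c / 2).
have s0 : 0 < s by rewrite lt_max (divr_gt0 c0)// orbT.
have sc' : s < c by rewrite gt_max sc; lra.
have Ms : quadform_le s M.
  move=> x; apply: le_trans (quadform_le_sigma1 M x) _.
  rewrite ler_wpM2r ?le_max ?lexx// sumr_ge0// => i _; exact: sqr_ge0.
have h1 := mxtrace_le_nuc (signmx_sym E) s0 Ms.
have h2 : \sum_i \sum_j M i j <= s * n%:R.
  apply: le_trans (ler_norm _) _; have := Ms (fun=> 1).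
  rewrite expr1n sumr_const card_ord; apply: le_trans.
  rewrite le_eqVlt; apply/orP; left; apply/eqP; congr (`|_|).
  by apply: eq_bigr => i _; apply: eq_bigr => j _; rewrite !mulr1.
have nuc0 := nuc_ge0 (signmx_sym E); have n0' : 0 < n%:R :> R by rewrite ltr0n.
move: cE; rewrite (admissible_duality EP adm); nra.
Qed.

(** Test the form on [e_a + e_b] and [e_a - e_b], of squared norm 2. The diagonal entries cancel in
    the difference. *)
Lemma quadform_le_offdiag (M : 'M[R]_n) a b : quadform_le 1 M -> a != b ->
  `|M a b + M b a| <= 2.
Proof.
move=> M1 ab; have ba : b != a by rewrite eq_sym.
have sumE c (g : 'I_n -> R) : \sum_i ((i == a)%:R + c * (i == b)%:R) * g i = g a + c * g b.
  rewrite (bigD1 a)//= (bigD1 b)//= big1 => [|i /andP[ia ib]].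
    by rewrite !eqxx (negbTE ab) (negbTE ba) /=; ring.
  by rewrite (negbTE ia) (negbTE ib) mulr0 addr0 mul0r.
have h c : c ^+ 2 = 1 -> `|M a a + M b b + c * (M a b + M b a)| <= 2.
  move=> c1; have := M1 (fun i => (i == a)%:R + c * (i == b)%:R).
  under [X in `|X| <= _]eq_bigr => i _ do
    under eq_bigr => j _ do rewrite mulrCA [M i j * _]mulrC.
  under [X in `|X| <= _]eq_bigr => i _ do rewrite -mulr_sumr sumE.
  under [X in _ <= 1 * X]eq_bigr => i _ do rewrite expr2.
  rewrite !sumE !eqxx (negbTE ab) (negbTE ba) mul1r.
  have -> : M a a + c * M a b + c * (M b a + c * M b b) =
    M a a + M b b * c ^+ 2 + c * (M a b + M b a) by ring.
  have -> : true%:R + c * false%:R + c * (false%:R + c * true%:R) = 1 + c ^+ 2 :> R.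
    by rewrite /=; ring.
  by rewrite c1 mulr1.
have := h 1 (expr1n _ _); have := h (-1) (sqrr_sign _ 1).
by rewrite !ler_norml; lra.
Qed.

Lemma mxtrace_edge_le (M : 'M[R]_n) e t : quadform_le 1 M -> `|t| <= 2 ->
  (e.1 == e.2 -> t = 0) ->
  \sum_i \sum_j (if edge i j == e then t else 0) * M j i <= 4.
Proof.
case: e => a b /= M1 t2 tab; rewrite pair_bigA /=.
(* A pair that is not increasing is never [edge i j], unless it is a loop, where [t] is 0. *)
have [ab|] := boolP (a < b)%N; last first.
  rewrite -leqNgt leq_eqVlt => /orP[/eqP/val_inj ba|ba].
    rewrite big1// => -[i j] _ /=; case: ifP; last by rewrite mul0r.
    by rewrite tab ?mul0r// ba.
  rewrite big1// => -[i j] _ /=; case: ifP; last by rewrite mul0r.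
  rewrite /edge; case: ifP => ij /eqP[ia jb]; first by move: ij; rewrite ia jb ltnNge (ltnW ba).
  by rewrite -ia -jb ij in ba.
have nab : a != b by rewrite -val_eqE (ltn_eqF ab).
rewrite (bigD1 (a, b))//= (bigD1 (b, a))//=; last first.
  by apply/eqP => -[ba _]; rewrite ba eqxx in nab.
rewrite big1 => [|[i j] /andP[/= p1 p2]]; last first.
  case: ifP => [/eqP ije|]; last by rewrite mul0r.
  have {}ije : edge i j = edge a b by rewrite ije /edge ab.
  by case/edge_eq: ije p1 p2 => -[-> ->]; rewrite !eqxx.
rewrite [edge b a]edgeC {1 2}/edge ab eqxx addr0 -mulrDr.
apply: le_trans (ler_norm _) _; rewrite normrM addrC.
have := quadform_le_offdiag M1 nab; have := normr_ge0 t.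
have := normr_ge0 (M a b + M b a); nra.
Qed.

Lemma nuc_signmx_le E e :
  `|nuc (signmx R (e |: E)) - nuc (signmx R E)| <= 4.
Proof.
have main (A B : {set 'I_n * 'I_n}) : (forall f, f != e -> (f \in A) = (f \in B)) ->
    nuc (signmx R A) <= nuc (signmx R B) + 4.
  move=> AB; apply: nuc_le; first exact: signmx_sym.
  move=> M M1; rewrite -[signmx R A](subrK (signmx R B)) mulmxDl mxtraceD addrC.
  apply: lerD; first by have := mxtrace_le_nuc (signmx_sym B) ltr01 M1; rewrite mul1r.
  have -> : \tr ((signmx R A - signmx R B) *m M) = \sum_i \sum_j
      (if edge i j == e then edge_sign R A e - edge_sign R B e else 0) * M j i.
    apply: eq_bigr => i _; rewrite mxE; apply: eq_bigr => j _; rewrite !mxE.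
    case: eqP => [-> //|/eqP/AB ABe]; congr (_ * _).
    by rewrite /edge_sign ABe subrr.
  apply: mxtrace_edge_le => // [|ee]; last by rewrite /edge_sign ee subrr.
  have := edge_sign_norm R A e; have := edge_sign_norm R B e; rewrite !ler_norml; lra.
have h1 := main (e |: E) E; have h2 := main E (e |: E).
have AB f : f != e -> (f \in e |: E) = (f \in E) by move=> fe; rewrite !inE (negbTE fe).
have {}h1 := h1 AB; have {}h2 := h2 (fun f fe => esym (AB f fe)).
by rewrite ler_norml; lra.
Qed.

End Graph.

End NuclearNorm.

(** * Mean of the nuclear norm *)
Section ExpectedNuclearNorm.
Variable R : realType.

(** Sum the majorant of [|x|] over the eigenvalues and replace each trace by its semicircle value.
    Powers of [4 - w^2] up to [m] occur, hence the length [2 m + 1] of the recurrence. *)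
Lemma mxtrace_le_chebyshev m (K : R) : odd m -> 0 <= K -> exists2 C : R, 0 <= C &
  forall n (w : 'M[R]_n) q r M, chebyshev_system K m.*2.+1 w q r -> w^T = w ->
    quadform_le 1 M ->
    \tr (w *m M) <= 2 * semicircle_sqrt_taylor R m * n%:R + C * Num.sqrt n%:R.
Proof.
move=> om K0.
have /choice[C hC] : forall b, exists C : R, 0 <= C /\ forall L n w q r,
    @chebyshev_system R K L n w q r -> (b.*2 < L)%N ->
    `|\tr ((4%:R - w ^+ 2) ^+ b) - 'C(b.*2.+1, b.+1)%:R * n%:R| <= C * Num.sqrt n%:R.
  move=> b; have [C C0 h] := mxtrace_edge_pow b 0 K0; exists C; split => // L n w q r sys bL.
  have [q0 _ _ _ _] := sys; have := h _ _ _ _ _ sys.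
  by rewrite q0 mulr1 expr0 mul1r !addn0; apply.
pose c k : R := wallis R k / k.*2.+2%:R / 4 ^+ k.+1.
have c0 k : 0 <= c k by rewrite !divr_ge0// ltW// wallis_gt0.
exists (2 * \sum_(k < m) c k * C k.+1).
  by rewrite mulr_ge0// sumr_ge0// => k _; rewrite mulr_ge0//; case: (hC k.+1).
move=> n w q r M sys wsym M1.
have [d [dM dtr]] := spectral_trace wsym.
apply: le_trans (dM _ _ M1) _; rewrite mul1r.
apply: le_trans (_ : 2 * (n%:R - \sum_(k < m) c k * \tr ((4%:R - w ^+ 2) ^+ k.+1)) <= _).
  rewrite (_ : n%:R - _ = \sum_i sqrt_taylor m ((4 - d i ^+ 2) / 4)).
    by rewrite mulr_sumr; apply: ler_sum => i _; exact: normr_le_sqrt_taylor.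
  rewrite /sqrt_taylor sumrB sumr_const card_ord; congr (_ - _).
  rewrite exchange_big; apply: eq_bigr => k _; rewrite dtr mulr_sumr.
  by apply: eq_bigr => i _; rewrite expr_div_n /c -!mulrA; congr (_ * (_ * _)); rewrite mulrC.
rewrite -!mulrA -mulrDr ler_wpM2l// /semicircle_sqrt_taylor mulrBl mul1r -[leRHS]addrA lerD2l.
rewrite -subr_ge0 opprK !mulr_suml addrC -sumrB -big_split /= sumr_ge0// => k _.
have [_ h] := hC k.+1; have {h} := h _ _ _ _ _ sys.
have -> : (k.+1.*2 < m.*2.+1)%N by clear -k; have := ltn_ord k; lia.
move=> /(_ isT); rewrite ler_norml => /andP[h _].
have := c0 k; have -> : wallis R k / k.*2.+2%:R * ('C(k.+1.*2.+1, k.+2)%:R / 4 ^+ k.+1) * n%:R =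
  c k * ('C(k.+1.*2.+1, k.+2)%:R * n%:R) by rewrite /c; ring.
move: h; move: (\tr _) (_ * n%:R) (Num.sqrt _) (c k) (C _) => a b s e f; nra.
Qed.

(** * The scaled walk matrices as a Chebyshev system *)

Section System.
Variables (n : nat) (n0 : (0 < n)%N).
Implicit Types (E : {set 'I_n * 'I_n}).
Let s : R := Num.sqrt n%:R.

Definition scaled_signmx E : 'M[R]_n := s^-1 *: signmx R E.
Definition scaled_pathmx E k : 'M[R]_n := s ^- k *: pathmx R k E.
(** The recurrence has errors only from index 1 on; 0 at index 0 meets the norm bound trivially. *)
Definition defectmx E k : 'M[R]_n := if k is k'.+1 then
  scaled_signmx E * scaled_pathmx E k - scaled_pathmx E k.+1 - scaled_pathmx E k' else 0.

Lemma sqrtn_gt0 : 0 < s. Proof. by rewrite sqrtr_gt0 ltr0n. Qed.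

Lemma sqr_sqrtn k : (s ^+ k) ^+ 2 = n%:R ^+ k.
Proof. by rewrite -exprM mulnC exprM sqr_sqrtr. Qed.

Lemma Ex_scaled_pathmx k :
  Ex (pairs_lt n) (fun E => fsq (scaled_pathmx E k)) <= (k.+1 ^ k)%:R * n%:R.
Proof.
have nn : 0 < n%:R ^+ k :> R by rewrite exprn_gt0// ltr0n.
under eq_Ex do rewrite fsqZ exprVn sqr_sqrtn.
rewrite ExZ mulrC ler_pdivrMr//; apply: le_trans (Ex_fsq_pathmx _ _ _) _.
by rewrite exprS -mulrA mulrCA mulrA.
Qed.

(** Of the backtracking factor [n - (k + 1)], scaling turns [n] into the exact coefficient 1; the
    [k + 1] joins the lassos as error. *)
Lemma defectmxE E k : defectmx E k.+1 =
  s ^- k.+2 *: (lassomx R k.+2 E - k.+1%:R *: pathmx R k E).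
Proof.
have s0 : s != 0 by rewrite gt_eqF// sqrtn_gt0.
rewrite /defectmx /scaled_signmx /scaled_pathmx -[_ * _]/(_ *m _) -scalemxAl -scalemxAr.
rewrite scalerA signmx_pathmx.
have -> : s^-1 * s ^- k.+1 = s ^- k.+2 by rewrite [in RHS]exprS invfM.
rewrite !scalerDr scalerN !scalerA mulrBr scalerBl.
have -> : s ^- k.+2 * n%:R = s ^- k.
  by rewrite -(sqr_sqrtr (ler0n R n)) -/s -addn2 exprD invfM -mulrA mulVf ?mulr1// expf_neq0.
move: (s ^- k.+2 *: pathmx R k.+2 E) (s ^- k *: pathmx R k E)
  ((s ^- k.+2 * k.+1%:R) *: pathmx R k E) (s ^- k.+2 *: lassomx R k.+2 E) => A B C D.
by apply/matrixP => i j; rewrite !mxE; ring.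
Qed.

Lemma Ex_defectmx k : Ex (pairs_lt n) (fun E => fsq (defectmx E k.+1)) <=
  2 * ((k.+3 ^ k.+2 * k.+2)%:R + k.+1%:R ^+ 2 * (k.+1 ^ k)%:R).
Proof.
have nn : 0 < n%:R ^+ k.+2 :> R by rewrite exprn_gt0// ltr0n.
under eq_Ex do rewrite defectmxE fsqZ exprVn sqr_sqrtn.
rewrite ExZ mulrC ler_pdivrMr//.
apply: le_trans (_ : Ex (pairs_lt n) (fun E => 2 * (fsq (lassomx R k.+2 E) +
  k.+1%:R ^+ 2 * fsq (pathmx R k E))) <= _).
  by apply: le_Ex => E _; apply: le_trans (fsqD_le _ _) _; rewrite fsqN fsqZ.
rewrite ExZ ExD ExZ -[leRHS]mulrA ler_wpM2l// mulrDl lerD ?Ex_fsq_lassomx//.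
rewrite -[leRHS]mulrA ler_wpM2l ?sqr_ge0//.
apply: le_trans (Ex_fsq_pathmx _ _ _) _; by rewrite ler_wpM2l// ler_weXn2l// ler1n.
Qed.

Lemma scaled_chebyshev_system K L E :
  (forall k, (k <= L)%N -> fsq (scaled_pathmx E k) <= K * n%:R /\ fsq (defectmx E k) <= K) ->
  chebyshev_system K L (scaled_signmx E) (scaled_pathmx E) (defectmx E).
Proof.
move=> h; split => //.
- by rewrite /scaled_pathmx expr0 invr1 scale1r pathmx0.
- rewrite /scaled_pathmx expr0 invr1 scale1r pathmx0 -[LHS]/(_ *m _) mulmx1.
  by rewrite expr1 pathmx1.
- move=> k _ /=; move: (scaled_signmx E * _) (scaled_pathmx E k.+2) (scaled_pathmx E k).
  by move=> A B C; apply/matrixP => i j; rewrite !mxE; ring.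
(* A self-avoiding walk of positive length does not return to its start, so the diagonal is zero. *)
- move=> k; rewrite linearZ /= /mxtrace big1 ?mulr0// => i _.
  rewrite mxE big1// => t; case/tupleP: t => a t /andP[+ /eqP /= ti].
  by rewrite cons_uniq -[X in X \notin _]ti mem_last.
Qed.

Lemma scaled_signmx_sym E : (scaled_signmx E)^T = scaled_signmx E.
Proof. by rewrite linearZ /= signmx_sym. Qed.

End System.

Lemma nat_ge (x : R) : exists N, forall n, (N <= n)%N -> x <= n%:R.
Proof.
exists (Num.truncn `|x|).+1 => n Nn; apply: le_trans (ler_norm _) _.
have /truncn_itv/andP[_ /ltW] := normr_ge0 x.
by move=> h; apply: le_trans h _; rewrite ler_nat.
Qed.

(* Averaging one nonnegative functional yields a graph on which all the norms
   required by the Chebyshev recurrence are bounded and [nuc] is close to its mean;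
   the deterministic bound there then bounds the mean itself. *)
Lemma Ex_nuc_le (delta : R) : 0 < delta -> exists N, forall n, (N <= n)%N ->
  Ex (pairs_lt n) (fun E => nuc (signmx R E)) <=
  (8 / (3 * pi) + delta) * n%:R * Num.sqrt n%:R.
Proof.
move=> d0.
have [m om md] : exists2 m, odd m & 2 / m%:R <= delta / 2.
  have [N0 hN0] := nat_ge (4 / delta); exists N0.*2.+1; first by rewrite /= odd_double.
  have : 4 / delta <= N0.*2.+1%:R by apply: hN0; clear; lia.
  by rewrite ler_pdivrMr ?ltr0n// ler_pdivrMr//; lra.
have m0 : (0 < m)%N by case: m om {md}.
pose L := m.*2.+1.
pose b k : R := (k.+1 ^ k)%:R.
pose b' k : R := if k is k'.+1 then
  2 * ((k'.+3 ^ k'.+2 * k'.+2)%:R + k'.+1%:R ^+ 2 * (k'.+1 ^ k')%:R) else 0.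
have b0 k : 0 <= b k by [].
have b'0 k : 0 <= b' k by case: k => [|k]; rewrite /b' ?mulr_ge0// addr_ge0// mulr_ge0// sqr_ge0.
pose B := 1 + \sum_(k < L.+1) (b k + b' k).
have B0 : 0 < B by rewrite ltr_pwDl// sumr_ge0// => k _; exact: addr_ge0.
have [C C0 hC] := mxtrace_le_chebyshev om (mulr_ge0 (ler0n R 2) (ltW B0)).
(* From here on [(C + 3) n] is at most [(delta / 2) n^(3/2)]; [C] comes from the traces, 3 from the
   passage to the mean. *)
have [N hN] := nat_ge ((2 * (C + 3) / delta) ^+ 2).
exists N.+1 => n Nn.
have n0 : (0 < n)%N by exact: leq_trans Nn.
have nR : 0 < n%:R :> R by rewrite ltr0n.
set s : R := Num.sqrt n%:R; have s0 : 0 < s := sqrtn_gt0 n0.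
have ss : s ^+ 2 = n%:R by rewrite sqr_sqrtr.
have sN : 2 * (C + 3) <= delta * s.
  rewrite [leRHS]mulrC -ler_pdivrMr// -[leLHS]ger0_norm; last first.
    by rewrite divr_ge0 ?(ltW d0)// mulr_ge0// addr_ge0.
  by rewrite -sqrtr_sqr ler_wsqrtr// hN// ltnW.
pose X (E : {set 'I_n * 'I_n}) :=
  \sum_(k < L.+1) (fsq (scaled_pathmx E k) / n%:R + fsq (defectmx E k)).
pose mu := Ex (pairs_lt n) (fun E => nuc (signmx R E)); rewrite -/mu.
have XB : Ex (pairs_lt n) X <= B.
  rewrite Ex_sum; apply: ler_wpDl => //; apply: ler_sum => k _; rewrite ExD lerD//.
    under eq_Ex do rewrite mulrC.
    by rewrite ExZ mulrC ler_pdivrMr// Ex_scaled_pathmx.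
  case: (k : nat) => [|k']; last exact: Ex_defectmx.
  rewrite (_ : Ex _ _ = 0)// -[RHS](Ex_cst (pairs_lt n)); apply: eq_Ex => E _ /=.
  by rewrite -(scale0r 0) fsqZ expr2 !mul0r.
have nucV : Ex (pairs_lt n) (fun E => (nuc (signmx R E) - mu) ^+ 2) <= 4 * n%:R ^+ 2.
  apply: le_trans (variance_le (c := 4) _ _) _ => [E e|]; first exact: nuc_signmx_le.
  have -> : 4 ^+ 2 / 4 = 4 :> R by field.
  rewrite ler_wpM2l// -natrX ler_nat; apply: leq_trans (max_card _) _.
  by rewrite card_prod card_ord.
(* Both summands are nonnegative with mean at most 1, so at the chosen graph each is at most 2. *)
have [E ES FE] := exists_le_Ex (pairs_lt n)
  (fun E => B^-1 * X E + (4 * n%:R ^+ 2)^-1 * (nuc (signmx R E) - mu) ^+ 2).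
have {}FE : B^-1 * X E + (4 * n%:R ^+ 2)^-1 * (nuc (signmx R E) - mu) ^+ 2 <= 2.
  apply: le_trans FE _; rewrite ExD !ExZ (_ : 2 = 1 + 1)// lerD//.
    by rewrite mulrC ler_pdivrMr// mul1r.
  by rewrite mulrC ler_pdivrMr ?mul1r// mulr_gt0// exprn_gt0.
have t0 (k : 'I_L.+1) : 0 <= fsq (scaled_pathmx E k) / n%:R + fsq (defectmx E k).
  by rewrite addr_ge0 ?divr_ge0 ?fsq_ge0.
have XE : X E <= 2 * B.
  have : B^-1 * X E <= 2.
    apply: le_trans FE; rewrite ler_wpDr// mulr_ge0 ?sqr_ge0// invr_ge0 mulr_ge0// sqr_ge0.
  by rewrite mulrC ler_pdivrMr.
have VE : (nuc (signmx R E) - mu) ^+ 2 <= 8 * n%:R ^+ 2.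
  have : (4 * n%:R ^+ 2)^-1 * (nuc (signmx R E) - mu) ^+ 2 <= 2.
    apply: le_trans FE; rewrite ler_wpDl// mulr_ge0 ?invr_ge0 ?(ltW B0)//.
    by rewrite sumr_ge0.
  rewrite mulrC ler_pdivrMr; first by lra.
  by rewrite mulr_gt0// exprn_gt0.
have sys : chebyshev_system (2 * B) L (scaled_signmx E) (scaled_pathmx E) (defectmx E).
  apply: scaled_chebyshev_system => // k kL.
  have : fsq (scaled_pathmx E k) / n%:R + fsq (defectmx E k) <= 2 * B.
    apply: le_trans XE; rewrite /X (bigD1 (Ordinal (kL : (k < L.+1)%N)))//= lerDl.
    by apply: sumr_ge0 => i _; exact: t0.
  have := fsq_ge0 (defectmx E k); have := divr_ge0 (fsq_ge0 (scaled_pathmx E k)) (ltW nR).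
  move=> h1 h2 h3; split; last by lra.
  by rewrite -ler_pdivrMr//; lra.
have nucE : nuc (signmx R E) <= s * (2 * semicircle_sqrt_taylor R m * n%:R + C * s).
  apply: nuc_le; first exact: signmx_sym.
  move=> M M1; have := hC _ _ _ _ _ sys (scaled_signmx_sym E) M1.
  by rewrite /scaled_signmx -scalemxAl linearZ /= ler_pdivrMl.
(* The squared deviation is at most [8 n^2], below [(3 n)^2]. *)
have nucmu : mu <= nuc (signmx R E) + 3 * n%:R.
  by rewrite -subr_ge0; move: VE nR; move: (nuc _) (mu) (n%:R : R) => x y z; nra.
have sm := semicircle_sqrt_taylor_le R m0.
apply: le_trans nucmu _; apply: le_trans (lerD nucE (lexx _)) _.
rewrite -ss.
apply: le_trans (_ : s * ((8 / (3 * pi) + 2 / m%:R) * s ^+ 2 + C * s) + 3 * s ^+ 2 <= _).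
  by rewrite lerD2r ler_wpM2l ?(ltW s0)// lerD2r ler_wpM2r// ?sqr_ge0.
apply: le_trans (_ : s * ((8 / (3 * pi) + delta / 2) * s ^+ 2 + C * s) + 3 * s ^+ 2 <= _).
  by rewrite lerD2r ler_wpM2l ?(ltW s0)// lerD2r ler_wpM2r// ?sqr_ge0// lerD2l.
rewrite -subr_ge0.
have -> : (8 / (3 * pi) + delta) * s ^+ 2 * s -
  (s * ((8 / (3 * pi) + delta / 2) * s ^+ 2 + C * s) + 3 * s ^+ 2) =
  s ^+ 2 * (delta * s - 2 * (C + 3)) / 2.
  have := pi_gt0 R; move: (pi : R) => p p0.
  by field; rewrite gt_eqF.
by rewrite divr_ge0// mulr_ge0 ?sqr_ge0// subr_ge0.
Qed.

End ExpectedNuclearNorm.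

(** * Concentration *)
Section RandomGraph.
Import mathcomp.boot.fintype mathcomp.boot.finset.
Variable R : realType.
Implicit Types (n : nat).

Lemma prob_GnE n (P : {set 'I_n * 'I_n} -> Prop) :
  prob_Gn R P = Ex (pairs_lt n) (fun E => `[< P E >]%:R).
Proof.
rewrite /prob_Gn /Ex /graphs card_powerset natrX; congr (_ / _).
rewrite -sum1_card natr_sum big_mkcond [RHS]big_mkcond; apply: eq_bigr => E _.
by rewrite inE; case: (_ \in _); case: `[< _ >].
Qed.

Lemma card_pairs_lt n : #|pairs_lt n|%:R = n%:R * (n%:R - 1) / 2 :> R.
Proof.
have -> : #|pairs_lt n|%:R = \sum_(i < n) \sum_(j < n) (i < j)%N%:R :> R.
  rewrite pair_bigA -sum1_card natr_sum big_mkcond; apply: eq_bigr => -[i j] _ /=.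
  by rewrite inE /=; case: (i < j)%N.
set S := \sum_(i < n) _.
have : S + S + n%:R = n%:R * n%:R.
  have nE : n%:R = \sum_(i < n) \sum_(j < n) (i == j)%:R :> R.
    rewrite -[in LHS](card_ord n) -sum1_card natr_sum; apply: eq_bigr => i _.
    rewrite (bigD1 i)//= eqxx big1 ?addr0// => j ji.
    by rewrite eq_sym (negbTE ji).
  rewrite [X in _ + _ + X]nE {2}/S exchange_big -!big_split /=.
  have -> : n%:R * n%:R = \sum_(i < n) \sum_(j < n) 1 :> R.
    under eq_bigr do rewrite sumr_const card_ord.
    by rewrite sumr_const card_ord -mulrnA natrM.
  apply: eq_bigr => i _; rewrite -!big_split /=; apply: eq_bigr => j _ /=.
  by rewrite -val_eqE /=; case: ltngtP; rewrite /= ?addr0 ?add0r.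
by move=> h; lra.
Qed.

Lemma Ex_card n : Ex (pairs_lt n) (fun E => #|E|%:R) = n%:R * (n%:R - 1) / 4 :> R.
Proof.
transitivity (\sum_(p in pairs_lt n) (2^-1 : R)); last first.
  by rewrite sumr_const -[2^-1 *+ _]mulr_natl card_pairs_lt; field.
have half p : p \in pairs_lt n -> Ex (pairs_lt n) (fun E => (p \in E)%:R) = 2^-1 :> R.
  move=> pS; have := Ex_flip (fun E => (p \in E)%:R : R) pS.
  have -> : Ex (pairs_lt n) (fun E => (p \in flip p E)%:R : R) =
      Ex (pairs_lt n) (fun E => 1 + - (p \in E)%:R).
    by apply: eq_Ex => E _; rewrite in_flip eqxx; case: (p \in E) => /=; ring.
  by rewrite ExD Ex_cst ExN; lra.
rewrite -(eq_bigr _ half) -Ex_sum; apply: eq_Ex => E /subsetP ES.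
rewrite -sum1_card natr_sum big_mkcond [RHS]big_mkcond; apply: eq_bigr => p _.
case: (boolP (p \in E)) => [/ES ->//|_]; by case: ifP.
Qed.

Lemma rho_bar_whp (eps : R) : 0 < eps -> exists N, forall n, (N <= n)%N ->
  1 - 1125 / eps ^+ 2 / n%:R <=
  prob_Gn R (fun E : {set 'I_n * 'I_n} =>
    rho_bar_ge E ((3 * pi / 8 - eps) * Num.sqrt n%:R)).
Proof.
(* The factor 15 yields [(3 pi / 8 - eps) (8 / (3 pi) + 3 d) <= 1 - 5 d]. The [3 d] collects the
   error of the mean of [nuc], its deviation, and the term [n]; the [5 d] collects [4 d] for the
   deviation of the edge count and [d] for its mean. *)
move=> eps0; pose d := eps / 15; have d0 : 0 < d by rewrite divr_gt0.
have [N1 hN1] := Ex_nuc_le d0.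
have [N2 hN2] := nat_ge (1 / d ^+ 2).
have [N3 hN3] := nat_ge (1 / d).
exists (N1 + N2 + N3).+1 => n Nn.
have [n1 n2 n3] : [/\ (N1 <= n)%N, (N2 <= n)%N & (N3 <= n)%N].
  by clear -Nn; split; lia.
have n0 : (0 < n)%N by exact: leq_trans Nn.
have nR : 0 < n%:R :> R by rewrite ltr0n.
have nR1 : 1 <= n%:R :> R by rewrite ler1n.
set s : R := Num.sqrt n%:R; have s0 : 0 < s := sqrtn_gt0 R n0.
have ss : s ^+ 2 = n%:R by rewrite sqr_sqrtr.
have sd : 1 <= d * s.
  rewrite mulrC -ler_pdivrMr// -[leLHS]ger0_norm; last by rewrite divr_ge0// ltW.
  by rewrite -sqrtr_sqr ler_wsqrtr// expr_div_n expr1n hN2.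
have nd : 1 <= d * n%:R by rewrite mulrC -ler_pdivrMr// hN3.
pose f (E : {set 'I_n * 'I_n}) := nuc (signmx R E).
pose g (E : {set 'I_n * 'I_n}) : R := #|E|%:R.
pose a := d * (n%:R * s); pose b := d * n%:R ^+ 2.
have a0 : 0 < a by rewrite !mulr_gt0.
have b0 : 0 < b by rewrite mulr_gt0// exprn_gt0.
have lipg E e : `|g (e |: E) - g E| <= 1.
  rewrite /g cardsU1 natrD addrK; by case: (_ \notin _); rewrite ?normr1 ?normr0.
have Pf := chebyshev_le (pairs_lt n) a0 (fun E e => nuc_signmx_le R E e : `|f (e |: E) - f E| <= 4).
have Pg := chebyshev_le (pairs_lt n) b0 lipg.
rewrite prob_GnE.
(* Union bound over the two deviation events. *)
apply: le_trans (_ : Ex (pairs_lt n) (fun E => 1 +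
  - (((a <= `|f E - Ex (pairs_lt n) f|)%R)%:R + ((b <= `|g E - Ex (pairs_lt n) g|)%R)%:R)) <= _);
  last first.
  apply: le_Ex => E ES.
  have [_|fE] := leP a _; first by case: (b <= _); case: `[< _ >] => /=; lra.
  have [_|gE] := leP b _; first by case: `[< _ >] => /=; lra.
  suff /asboolT -> : rho_bar_ge E ((3 * pi / 8 - eps) * s) by rewrite /= addr0 oppr0 addr0.
  (* A nonpositive target is met because [sigma1] is nonnegative, as the form at the all-ones vector
     shows. *)
  have [c0|c0] := ltP 0 ((3 * pi / 8 - eps) * s); last first.
    move=> M _; apply: le_trans c0 _.
    have := quadform_le_sigma1 M (fun=> 1); rewrite expr1n sumr_const card_ord.
    by move=> /(le_trans (normr_ge0 _)); rewrite pmulr_lge0.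
  apply: rho_bar_ge_nuc => //.
  have {}fE : nuc (signmx R E) <= (8 / (3 * pi) + 2 * d) * n%:R * s.
    have := hN1 n n1; rewrite -/s; move: fE; rewrite -/(f E) ltr_norml /a => /andP[_].
    by lra.
  have {}gE : n%:R ^+ 2 * (1 - 5 * d) <= 4 * #|E|%:R.
    move: gE; rewrite -/(g E) ltr_norml Ex_card /b => /andP[+ _]; rewrite /g.
    nra.
  apply: le_trans gE.
  apply: le_trans (_ : (3 * pi / 8 - eps) * s * ((8 / (3 * pi) + 3 * d) * n%:R * s) <= _).
    rewrite ler_wpM2l ?(ltW c0)//.
    rewrite mulrAC in fE; rewrite mulrAC.
    have : n%:R <= d * s * n%:R by rewrite ler_peMl// ltW.
    by move: fE; move: (nuc _) => x; lra.
  have -> : (3 * pi / 8 - eps) * s * ((8 / (3 * pi) + 3 * d) * n%:R * s) =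
      n%:R ^+ 2 * ((3 * pi / 8 - eps) * (8 / (3 * pi) + 3 * d)).
    by rewrite -ss; move: (8 / _) => A; ring.
  rewrite ler_wpM2l ?sqr_ge0//.
  have pi2 := pi_ge2 R; have pi4 : pi <= 4 :> R.
    by have := pihalf_lt2 R; lra.
  have -> : (3 * pi / 8 - eps) * (8 / (3 * pi) + 3 * d) =
      1 + 9 * pi / 8 * d - 15 * d * (8 / (3 * pi)) - 45 * d ^+ 2.
    have -> : eps = 15 * d by rewrite /d; field.
    by move: (pi : R) pi2 => p p2; field; rewrite gt_eqF//; lra.
  have : 2 / 3 <= 8 / (3 * pi) :> R.
    by move: (pi : R) pi2 pi4 => p p2 p4; rewrite ler_pdivlMr; lra.
  set A := _ / (3 * pi); move: A (pi : R) pi4 => A p p4 A2.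
  by have := sqr_ge0 d; nra.
rewrite ExD Ex_cst ExN ExD lerD2l lerN2.
have Sn : #|pairs_lt n|%:R <= n%:R ^+ 2 :> R.
  rewrite -natrX ler_nat; apply: leq_trans (max_card _) _.
  by rewrite card_prod card_ord.
(* [1125 = 5 * 15^2]: a share [4 / d^2] for [nuc] and [1 / d^2] for the edge count. *)
have -> : 1125 / eps ^+ 2 / n%:R = 4 / d ^+ 2 / n%:R + 1 / d ^+ 2 / n%:R :> R.
  by rewrite /d; field; rewrite !gt_eqF.
apply: lerD.
  apply: le_trans Pf _; rewrite ler_pdivrMr ?exprn_gt0//.
  have -> : 4 / d ^+ 2 / n%:R * a ^+ 2 = 4 ^+ 2 / 4 * n%:R ^+ 2.
    by rewrite /a !exprMn ss; field; rewrite !gt_eqF.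
  by rewrite ler_wpM2l.
apply: le_trans Pg _; rewrite ler_pdivrMr ?exprn_gt0//.
have -> : 1 / d ^+ 2 / n%:R * b ^+ 2 = n%:R * n%:R ^+ 2.
  by rewrite /b !exprMn; field; rewrite !gt_eqF.
apply: ler_pM => //; rewrite expr1n; lra.
Qed.

(* [eps n] is [1 / (m + 1)] for the largest [m <= n] whose threshold [N m] has been
   reached. *)
Lemma diagonalize (P : R -> nat -> Prop) :
  (forall e, 0 < e -> exists N, forall n, (N <= n)%N -> P e n) ->
  exists eps : nat -> R, (eps n @[n --> \oo] --> 0) /\
    exists N, forall n, (N <= n)%N -> P (eps n) n.
Proof.
move=> HP; have /choice[N hN] : forall m : nat, exists N, forall n, (N <= n)%N -> P m.+1%:R^-1 n.
  by move=> m; apply: HP; rewrite invr_gt0.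
pose k n := (\max_(m < n.+1 | (N m <= n)%N) m)%N.
exists (fun n => (k n).+1%:R^-1); split; last first.
  exists (N 0) => n Nn; rewrite /k.
  have [|i /hN + ->] := @eq_bigmax_cond _ (fun m : 'I_n.+1 => (N m <= n)%N) (fun m => m : nat).
    by apply/card_gt0P; exists ord0.
  by [].
apply/cvgrPdist_le => e e0; have [M hM] := nat_ge e^-1.
near=> n; rewrite sub0r normrN ger0_norm ?invr_ge0//.
have kM : (M <= k n)%N.
  have Mn : (M < n.+1)%N by near: n; exists M.
  have NMn : (N M <= n)%N by near: n; exists (N M).
  exact: (@leq_bigmax_cond _ (fun m : 'I_n.+1 => (N m <= n)%N) (fun m => m : nat) (Ordinal Mn)).
rewrite -[leRHS]invrK lef_pV2 ?posrE ?invr_gt0//; apply: hM.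
exact: leq_trans kM _.
Unshelve. all: by end_near.
Qed.

Lemma ln_ge (y : R) : exists N, forall n, (N <= n)%N -> y <= ln (n%:R : R).
Proof.
have [N hN] := nat_ge (expR y); exists N => n /hN h.
by rewrite -(expRK y) ler_ln// posrE ?expR_gt0// (lt_le_trans (expR_gt0 y)).
Qed.

End RandomGraph.

Theorem theoremD1 (R : realType) :
  exists eps : nat -> R, (eps n @[n --> \oo] --> 0) /\
  exists (C : R) (k N : nat),
    forall n : nat, (N <= n)%N ->
      1 - C * (ln (n%:R : R)) ^+ k / n%:R <=
      prob_Gn R (fun E : {set 'I_n * 'I_n} => rho_bar_ge E ((3 * pi / 8 - eps n) * Num.sqrt (n%:R : R))).
Proof.
(* The logarithm absorbs the constant [1125 / e ^+ 2], which depends on [e]. The failure bound is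
   then the same for all [e], and the statements for fixed [e] can be diagonalised. *)
have [|eps [eps0 [N hN]]] := @diagonalize R (fun e n => 1 - ln (n%:R : R) / n%:R <=
  prob_Gn R (fun E : {set 'I_n * 'I_n} => rho_bar_ge E ((3 * pi / 8 - e) * Num.sqrt (n%:R : R)))).
  move=> e e0; have [N1 h1] := rho_bar_whp e0; have [N2 h2] := ln_ge (1125 / e ^+ 2).
  exists (N1 + N2)%N => n Nn.
  have n1 : (N1 <= n)%N := leq_trans (leq_addr _ _) Nn.
  have n2 : (N2 <= n)%N := leq_trans (leq_addl _ _) Nn.
  apply: le_trans (h1 n n1); rewrite lerD2l lerN2 ler_wpM2r ?invr_ge0//.
  exact: h2.
exists eps; split=> //; exists 1, 1%N, N => n /hN.
by rewrite expr1 mul1r.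
Qed.
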